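(* Let $\widetilde N$ be the compensated Poisson random measure associated with a Poisson random measure on $\mathbb R^+\times\mathbb R_0$ with intensity $ds\,\nu(dx)$, where $\nu\not\equiv0$ is a Lévy measure with $\int x^2\,d\nu(x)<\infty$. For $\epsilon>0$ let $\sigma(\epsilon)^2=\int_{\{|x|\le\epsilon\}}x^2\,d\nu(x)$. Let $\{h_t\}_t$ be a family of deterministic functions $h_t(s,x)=h_t(s)$, not depending on $x$, with $h_t\in L^3(0,T)$ ($0\le t\le T$), and put $$F^\epsilon_t=\sigma(\epsilon)^{-1}\iint_{[0,t]\times\{|x|\le\epsilon\}}h_t(s)\,x\,d\widetilde N(s,x).$$ Let $\widehat W$ be an isonormal Gaussian process with covariance $\mathbb E[\widehat W(f)\widehat W(g)]=\int_{\mathbb R^+}f(s)g(s)\,ds$. If $\lim_{\epsilon\to0}\frac{\sigma(\epsilon)}{\epsilon}=\infty$, then, as $\epsilon\to0$, $F^\epsilon_t\stackrel{\rm law}{\approx}\widehat W(h_t)$; that is, for every $d\in\mathbb N$ and every finite set of times $t_1,\dots,t_d$, the vector $(F^\epsilon_{t_1},\dots,F^\epsilon_{t_d})$ converges in law to $(\widehat W(h_{t_1}),\dots,\widehat W(h_{t_d}))$ as $\epsilon\to0$.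
   Context: $\mathbb R_0=\mathbb R\setminus\{0\}$. The underlying Lévy process is the pure jump process $\iint_{[0,t]\times\mathbb R_0}x\,d\widetilde N(s,x)$ with triplet $(0,0,\nu)$. $\widehat W(h_t)$ is understood as $\widehat W(h_t1_{[0,t]})$, i.e. $h_t$ is regarded as a function supported on $[0,t]$. *)

(* Defs.v *)
From HB Require Import structures.
From mathcomp Require Import all_boot all_order all_algebra.
From mathcomp Require Import all_classical all_reals all_analysis.
From mathcomp Require Import measurable_realfun.

Set Implicit Arguments.
Unset Strict Implicit.
Unset Printing Implicit Defensive.

Import Order.TTheory GRing.Theory Num.Theory.
Import numFieldNormedType.Exports.
Import HBSimple.

Local Open Scope classical_set_scope.
Local Open Scope ring_scope.
Local Open Scope ereal_scope.

Definition mutually_independent (d dT : measure_display)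
    (Om : measurableType d) (E : measurableType dT) (R : realType)
    (P : probability Om R) (n : nat) (X : 'I_n -> Om -> E) : Prop :=
  forall B : 'I_n -> set E, (forall i, measurable (B i)) ->
    P (\bigcap_(i in [set: 'I_n]) (X i @^-1` B i)) =
    \prod_(i < n) P (X i @^-1` B i).

(* The random vectors [X eps] and their limit [Y] may live on different
   probability spaces. *)
Definition cvg_in_law_at_right0 (d d' : measure_display)
    (Om : measurableType d) (Om' : measurableType d') (R : realType)
    (P : probability Om R) (P' : probability Om' R) (n : nat)
    (X : R -> Om -> 'rV[R]_n) (Y : Om' -> 'rV[R]_n) : Prop :=
  forall phi : 'rV[R]_n -> R, continuous phi ->
    (exists M : R, forall v, (`|phi v| <= M)%R) ->
    'E_P[phi \o X eps] @[eps --> 0%R^'+] --> 'E_P'[phi \o Y].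

(* The values of the random measure [N] on [A] are [N w A]; being a kernel,
   [N] is a measure for each outcome [w] and each [N ^~ A] is measurable.
   The library's [poisson_prob] does not depend on its second argument; for
   rate 0 it is the Dirac mass at 0. *)
Definition is_poisson_random_measure (d dE : measure_display)
    (Om : measurableType d) (E : measurableType dE) (R : realType)
    (P : probability Om R) (N : R.-ker Om ~> E) (m : set E -> \bar R) : Prop :=
  [/\ forall A, measurable A -> m A < +oo -> forall k : nat,
        P [set w | N w A = k%:R%:E] = poisson_prob (fine (m A)) k [set k],
      forall A, measurable A -> m A = +oo -> {ae P, forall w, N w A = +oo} &
      forall (n : nat) (A : 'I_n -> set E), (forall i, measurable (A i)) ->
        trivIset [set: 'I_n] A ->
        mutually_independent P (fun i w => N w (A i))].

(* The integral of [g] with respect to the compensated measure [N - m], for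
   [g] simple and vanishing outside a set of finite [m]-measure. *)
Definition compensated_sint (d dE : measure_display)
    (Om : measurableType d) (E : measurableType dE) (R : realType)
    (N : R.-ker Om ~> E) (m : set E -> \bar R) (g : {sfun E >-> R})
    (w : Om) : R :=
  (fine (\int[N w]_z (g z)%:E)%E - fine (\int[m]_z (g z)%:E)%E)%R.

(* [X] is a version of the integral of [f] with respect to [N - m]: the
   isometric extension to L^2(m) of the integral of simple functions. *)
Definition is_compensated_integral (d dE : measure_display)
    (Om : measurableType d) (E : measurableType dE) (R : realType)
    (P : probability Om R) (N : R.-ker Om ~> E) (m : set E -> \bar R)
    (f : E -> R) (X : {RV P >-> R}) : Prop :=
  exists g : nat -> {sfun E >-> R},
    [/\ forall n, m [set z | g n z != 0%R] < +oo,
        \int[m]_z ((g n z - f z) ^+ 2)%:E @[n --> \oo] --> 0 &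
        'E_P[fun w => ((compensated_sint N m (g n) w - X w) ^+ 2)%R]
          @[n --> \oo] --> 0].

(* Measures on R \ {0} are represented as measures on R not charging 0. *)
Definition is_levy_measure (R : realType) (nu : {measure set R -> \bar R}) :
    Prop :=
  nu [set 0%R] = 0 /\ \int[nu]_x (Num.min 1 (x ^+ 2))%:E < +oo.

(* ds nu(dx) on [0, +oo[ x (R \ {0}), as a set function on R x R which is
   null outside this set. *)
Definition levy_intensity (R : realType) (nu : {measure set R -> \bar R}) :
    set (R * R) -> \bar R :=
  mrestr (@lebesgue_measure R) (measurable_itv `[0%R, +oo[) \x nu.

Definition small_jump_sd (R : realType) (nu : {measure set R -> \bar R})
    (eps : R) : R :=
  Num.sqrt (\int[nu]_(x in [set x | `|x| <= eps]) (x ^+ 2))%R.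

Definition small_jump_kernel (R : realType) (h : R -> R) (t eps : R)
    (z : R * R) : R :=
  (h z.1 * z.2 * \1_(`[0, t] `*` [set x | `|x| <= eps]) z)%R.

Definition in_L2_Rplus (R : realType) (f : R -> R) : Prop :=
  measurable_fun (`[0%R, +oo[ : set R) f /\
  \int[lebesgue_measure]_(s in `[0%R, +oo[) (f s ^+ 2)%:E < +oo.

(* Degenerate laws are included; [normal_prob m 0] is not a Dirac mass. *)
Definition centered_gaussian (R : realType) (v : R) : set R -> \bar R :=
  if v == 0%R then \d_(0%R : R) else normal_prob 0%R (Num.sqrt v).

(* Joint Gaussianity is expressed by the laws of linear combinations; the
   values of [W] outside L^2 are irrelevant. *)
Definition is_isonormal (d : measure_display) (Om : measurableType d)
    (R : realType) (P : probability Om R) (W : (R -> R) -> {RV P >-> R}) :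
    Prop :=
  (forall (n : nat) (f : 'I_n -> R -> R) (c : 'I_n -> R),
     (forall i, in_L2_Rplus (f i)) ->
     exists2 v : R, (0 <= v)%R &
       forall A, measurable A ->
         P [set w | A (\sum_(i < n) c i * W (f i) w)%R] =
         centered_gaussian v A) /\
  (forall f g : R -> R, in_L2_Rplus f -> in_L2_Rplus g ->
     'E_P[fun w => (W f w * W g w)%R] =
     \int[lebesgue_measure]_(s in `[0%R, +oo[) (f s * g s)%:E).

(* Main.v *)
(* For a square-integrable [f], the compensated Poisson integral [X] of [f]
   satisfies [E e^(iX) = exp (int (e^(if) - 1 - if) dm)], which differs from the
   Gaussian value [exp (- int f^2 dm / 2)] by at most a multiple of
   [int |f|^3 dm]: this is computed for simple functions from the Poisson
   distribution and passes to the limit in L^2.  For the linear combination with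
   coefficients [u] of the normalized small jump integrals,
   [f = H(s) x 1_(|x| <= eps) / sigma(eps)] with [H = sum_i u_i h_(t_i)], so
   [int f^2 dm = int H^2 ds] and
   [int |f|^3 dm <= (eps / sigma(eps)) int |H|^3 ds --> 0].
   Instead of Levy's continuity theorem, a bounded continuous function is
   approximated by a trigonometric polynomial within [eta (1 + |x|^2)], and the
   second moments stay bounded. *)
Require Import Defs.
From HB Require Import structures.
From mathcomp Require Import all_boot all_order all_algebra.
From mathcomp Require Import all_classical all_reals all_analysis.
From mathcomp Require Import measurable_realfun.
From mathcomp Require complex.
From mathcomp Require Import ring lra.

Set Implicit Arguments.
Unset Strict Implicit.
Unset Printing Implicit Defensive.

Import Order.TTheory GRing.Theory Num.Theory.
Import numFieldNormedType.Exports.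

Local Open Scope classical_set_scope.
Local Open Scope ring_scope.

(** * Trigonometric approximation and convergence in law *)

(** Characteristic functions appear as [E cos (X + b)] with a free real phase [b], which carries the
    real and the imaginary part together and keeps products of cosines in the span of cosines. The
    obstacle in the passage to the limit is that the simple functions [g] approximating [f] converge
    in L^2 only, so [int |g|^3 dm] is not controlled. The second-order remainder of [e^(ix)] is
    therefore bounded both by [x^2] and by [|x|^3]: where [|g| <= 2 |f|] the cube of [f] serves, and
    elsewhere [g^2 <= 4 (g - f)^2]. The exponents being compared are nonpositive, where [exp] is
    1-Lipschitz, so an estimate on exponents passes to characteristic functions without any
    smallness condition. The same estimate for [u f], as [u] tends to 0, also yields the second
    moments: its error of order [u^3] is negligible against [u^2]. *)

Section bernstein.
Variable R : realFieldType.
Implicit Types z : R.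

(** The Bernstein weight ['C(n, k) z^k (1 - z)^(n - k)], that is, the binomial probability of [k]
    successes. The recursion on one trial replaces binomial coefficients: moments and closure
    properties become inductions on [n]. *)
Fixpoint bweight (n k : nat) z : R :=
  if n is n'.+1 then
    (1 - z) * bweight n' k z + z * (if k is k'.+1 then bweight n' k' z else 0)
  else (k == 0%N)%:R.

Lemma bweight_small n k z : (n < k)%N -> bweight n k z = 0.
Proof.
elim: n k => [|n IH] [|k]//= nk.
by rewrite !IH ?mulr0 ?addr0// ltnW.
Qed.

Lemma bweight_ge0 n k z : 0 <= z <= 1 -> 0 <= bweight n k z.
Proof.
move=> /andP[z0 z1]; elim: n k => [|n IH] k /=; first exact: ler0n.
rewrite addr_ge0// mulr_ge0 ?subr_ge0//.
by case: k => //.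
Qed.

Lemma bweight_sumS n z (f : nat -> R) :
  \sum_(k < n.+2) bweight n.+1 k z * f k =
  (1 - z) * (\sum_(k < n.+1) bweight n k z * f k) +
  z * (\sum_(k < n.+1) bweight n k z * f k.+1).
Proof.
under eq_bigr do rewrite /= mulrDl -!mulrA.
rewrite big_split/= -!mulr_sumr; congr (_ * _ + _ * _).
  by rewrite big_ord_recr/= bweight_small// mul0r addr0.
by rewrite big_ord_recl/= mul0r add0r.
Qed.

Lemma bweight_sum1 n z : \sum_(k < n.+1) bweight n k z = 1.
Proof.
elim: n => [|n IH]; first by rewrite big_ord_recl big_ord0 addr0.
have := bweight_sumS n z (fun=> 1).
under eq_bigr do rewrite mulr1.
under [in X in _ = X -> _]eq_bigr do rewrite mulr1.
by move=> ->; rewrite IH !mulr1 subrK.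
Qed.

(** Binomial variance plus squared bias. The centre [c] is arbitrary because the induction moves it:
    a success in the last trial turns [c] into [c - 1]. *)
Lemma bweight_sum_sqr n z c :
  \sum_(k < n.+1) bweight n k z * (k%:R - c) ^+ 2 =
  n%:R * (z * (1 - z)) + (n%:R * z - c) ^+ 2.
Proof.
elim: n c => [|n IH] c; first by rewrite big_ord_recl big_ord0/=; ring.
rewrite (bweight_sumS n z (fun k => (k%:R - c) ^+ 2)) IH.
under eq_bigr do rewrite -natr1 -addrA -opprB.
by rewrite IH -natr1; ring.
Qed.

Lemma bweight_var n z : (0 < n)%N ->
  \sum_(k < n.+1) bweight n k z * (z - k%:R / n%:R) ^+ 2 = z * (1 - z) / n%:R.
Proof.
move=> n0; have n0' : n%:R != 0 :> R by rewrite pnatr_eq0 -lt0n.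
transitivity (n%:R ^- 2 *
  \sum_(k < n.+1) bweight n k z * (k%:R - n%:R * z) ^+ 2).
  by rewrite mulr_sumr; apply: eq_bigr => k _; field.
by rewrite bweight_sum_sqr; field.
Qed.

End bernstein.

Section trigpoly.
Variables (R : realType) (d : nat).
Implicit Types (x : 'rV[R]_d) (u : 'I_d -> R) (f g : 'rV[R]_d -> R).

(** The real span of the cosines of affine forms; the phase [b] supplies sines and constants. Sums
    and scalings are the only closure rules, so that convergence of expectations extends from
    cosines by linearity; closure under products is derived. *)
Inductive trigpoly : ('rV[R]_d -> R) -> Prop :=
| trigpoly_cos u b : trigpoly (fun x => cos (\sum_i u i * x ord0 i + b))
| trigpoly_add f g : trigpoly f -> trigpoly g -> trigpoly (fun x => f x + g x)
| trigpoly_scale a f : trigpoly f -> trigpoly (fun x => a * f x).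

Lemma trigpoly_cst a : trigpoly (fun=> a).
Proof.
rewrite (_ : (fun=> a) = (fun x => a * cos (\sum_i 0 * x ord0 i + 0))).
  exact/trigpoly_scale/(trigpoly_cos (fun=> 0)).
apply/funext => x; rewrite big1 ?addr0 ?cos0 ?mulr1// => i _.
by rewrite mul0r.
Qed.

(** By bilinearity it is enough to multiply two cosines, and [2 cos p cos q = cos (p + q) + cos (p -
    q)]. *)
Lemma trigpoly_mul f g :
  trigpoly f -> trigpoly g -> trigpoly (fun x => f x * g x).
Proof.
elim=> {f} [u b|f1 f2 _ IH1 _ IH2|a f _ IH] tg; last first.
- by under eq_fun do rewrite -mulrA; exact/trigpoly_scale/IH.
- by under eq_fun do rewrite mulrDl; apply: trigpoly_add; [exact: IH1|exact: IH2].
elim: tg => {g} [v c|f1 f2 _ IH1 _ IH2|a f _ IH]; last first.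
- by under eq_fun do rewrite mulrCA; exact/trigpoly_scale/IH.
- by under eq_fun do rewrite mulrDr; exact: trigpoly_add.
rewrite (_ : (fun x => _) = (fun x =>
    2^-1 * cos (\sum_i (u i + v i) * x ord0 i + (b + c)) +
    2^-1 * cos (\sum_i (u i - v i) * x ord0 i + (b - c)))).
  apply: trigpoly_add; apply: trigpoly_scale.
    exact: (trigpoly_cos (fun i => u i + v i)).
  exact: (trigpoly_cos (fun i => u i - v i)).
apply/funext => x.
under [in RHS]eq_bigr do rewrite mulrDl.
under [X in _ + _ * cos (X + _)]eq_bigr do rewrite mulrBl.
rewrite sumrB big_split/=.
set A := \sum_i _; set B := \sum_i _.
rewrite (_ : A + B + (b + c) = (A + b) + (B + c)); last by ring.
rewrite (_ : A - B + (b - c) = (A + b) - (B + c)); last by ring.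
by move: (A + b) (B + c) => p q; rewrite cosD cosB; field.
Qed.

Lemma trigpoly_sum (I : Type) (s : seq I) (F : I -> 'rV[R]_d -> R) :
  (forall i, trigpoly (F i)) -> trigpoly (fun x => \sum_(i <- s) F i x).
Proof.
move=> tF; elim: s => [|i s IH].
  by under eq_fun do rewrite big_nil; exact: trigpoly_cst.
by under eq_fun do rewrite big_cons; exact: trigpoly_add.
Qed.

Lemma trigpoly_prod (I : Type) (s : seq I) (F : I -> 'rV[R]_d -> R) :
  (forall i, trigpoly (F i)) -> trigpoly (fun x => \prod_(i <- s) F i x).
Proof.
move=> tF; elim: s => [|i s IH].
  by under eq_fun do rewrite big_nil; exact: trigpoly_cst.
by under eq_fun do rewrite big_cons; exact: trigpoly_mul.
Qed.

Lemma trigpoly_sin_coord (i : 'I_d) (a : R) :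
  trigpoly (fun x => sin (a * x ord0 i)).
Proof.
rewrite (_ : (fun x => _) =
    (fun x => cos (\sum_j (if j == i then a else 0) * x ord0 j - pi / 2))).
  exact: (trigpoly_cos (fun j => if j == i then a else 0)).
apply/funext => x; rewrite (bigD1 i)//= eqxx big1 ?addr0 ?cosBpihalf//.
by move=> j /negbTE ->; rewrite mul0r.
Qed.

Lemma trigpoly_bweight n k f : trigpoly f ->
  trigpoly (fun x => bweight n k (f x)).
Proof.
move=> tf; elim: n k => [|n IH] k /=; first exact: trigpoly_cst.
apply: trigpoly_add; apply: trigpoly_mul => //.
- apply: trigpoly_add; first exact: trigpoly_cst.
  by under eq_fun do rewrite -mulN1r; exact: trigpoly_scale.
- by case: k => [|k]//; exact: trigpoly_cst.
Qed.

Lemma trigpoly_bounded f : trigpoly f -> exists M, forall x, `|f x| <= M.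
Proof.
elim=> {f} [u b|f1 f2 _ [M1 h1] _ [M2 h2]|a f _ [M h]].
- by exists 1 => x; exact: cos_max.
- by exists (M1 + M2) => x; rewrite (le_trans (ler_normD _ _))// lerD.
- by exists (`|a| * M) => x; rewrite normrM ler_wpM2l.
Qed.

End trigpoly.

Section trig_approx.
Variable R : realType.

(** From [sin a - sin b = 2 cos ((a + b) / 2) sin ((a - b) / 2)]. The bounds are asymmetric because
    [a] will be a rescaled point of the cube and [b] the arcsine of a node, which fills the whole of
    [[-pi/2, pi/2]]; since [1/2 < pi/2], the half sum stays away from the zeros of the cosine. *)
Lemma sin_gap (e : R) : 0 < e -> exists2 c, 0 < c &
  forall a b, `|a| <= 2^-1 -> `|b| <= pi / 2 -> e <= `|a - b| ->
    c <= (sin a - sin b) ^+ 2.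
Proof.
move=> e0; have pih1 : (1 : R) <= pi / 2 := pihalf_ge1 R.
(* [m < pi / 2] bounds [|a + b| / 2] and [e'] is a lower bound of [|a - b| / 2], cut at [pi / 2] to
   stay where the sine increases. *)
pose m : R := (2^-1 + pi / 2) / 2; pose e' := Num.min (e / 2) (pi / 2).
have cm0 : 0 < cos m by apply: cos_gt0_pihalf; rewrite /m; lra.
have e'0 : 0 < e' by rewrite /e' lt_min; apply/andP; split; lra.
have e'h : e' <= pi / 2 by rewrite /e' ge_min lexx orbT.
have se'0 : 0 < sin e' by apply: sin_gt0_pi; lra.
exists ((2 * (cos m * sin e')) ^+ 2); first by rewrite exprn_gt0// !mulr_gt0.
move=> a b ha hb eab.
pose p := (a + b) / 2; pose q := (a - b) / 2.
rewrite (_ : a = p + q); last by rewrite /p /q; field.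
rewrite (_ : b = p - q); last by rewrite /p /q; field.
rewrite sinD sinB (_ : _ - _ = 2 * (cos p * sin q)); last by ring.
rewrite !exprMn [sin q ^+ 2]sin2cos2 -(cos_norm q) -sin2cos2 -(cos_norm p).
have n2 (x : R) : `|x / 2| = `|x| / 2 by rewrite normrM [`|2^-1|]ger0_norm.
have hp : `|p| <= m.
  by rewrite /p /m n2 ler_pM2r// (le_trans (ler_normD _ _))// lerD.
have hq : e' <= `|q|.
  by rewrite /e' ge_min /q n2 ler_pM2r ?eab.
have hq' : `|q| <= pi / 2.
  rewrite /q n2 ler_pM2r// (le_trans (ler_normB _ _))// (le_trans (lerD ha hb))//; lra.
rewrite -!exprMn lerXn2r ?nnegrE//.
- by rewrite mulr_ge0// mulr_ge0 ?ltW.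
- rewrite mulr_ge0// mulr_ge0//.
    by apply: cos_ge0_pihalf; rewrite /m in hp; have := normr_ge0 p; lra.
  by apply: sin_ge0_pi; have := normr_ge0 q; lra.
- rewrite ler_pM2l//; apply: ler_pM; [exact: ltW|exact: ltW| |].
    rewrite leNgt ltr_cos ?in_itv/= -?leNgt//.
      by rewrite /m; lra.
    by rewrite normr_ge0/=; rewrite /m in hp; lra.
  rewrite leNgt ltr_sin ?in_itv/= -?leNgt//.
    by rewrite hq' andbT; have := normr_ge0 q; lra.
  by rewrite e'h andbT; lra.
Qed.

(** The second point is not confined to [A]: the interpolation nodes close to a point of the cube
    may lie outside it. Compactness is used in its near-covering form, which gives one radius for
    all of [A]. *)
Lemma continuous_uniform_on_compact (d : nat) (phi : 'rV[R]_d -> R)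
    (A : set 'rV[R]_d) (e : R) : continuous phi -> compact A -> 0 < e ->
  exists2 r, 0 < r & forall x y, A x -> ball x r y -> `|phi x - phi y| <= e.
Proof.
move=> cphi /compact_near_coveringP cA e0.
have [s [s0 hs]] : exists s : R, 0 < s /\
    A `<=` (fun x => forall y, ball x s y -> `|phi x - phi y| <= e); last first.
  by exists s => // x y /hs; exact.
suff S : \forall s \near 0^'+,
    A `<=` (fun x => forall y, ball x s y -> `|phi x - phi y| <= e).
  exact: (@filter_ex _ (0^'+) _ _ (filterI (nbhs_right_gt 0) S)).
apply: cA => x Ax; have e20  : 0 < e / 2 by rewrite divr_gt0.
have /cvgrPdist_le/(_ _ e20)/nbhs_ballP[r /= r0 hr] := cphi x.
exists (ball x (r / 2), [set s | 0 < s < r / 2]).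
  split => /=; first by apply: nbhsx_ballx; rewrite divr_gt0.
  near=> s; apply/andP; split; near: s; first exact: nbhs_right_gt.
  by apply: nbhs_right_lt; rewrite divr_gt0.
move=> [x' s] /= [xx' /andP[s0 sr]] y x'y.
rewrite (le_trans (ler_distD (phi x) _ _))// [e]splitr lerD//.
  by rewrite distrC; apply: hr; apply: le_ball xx'; lra.
apply: hr; rewrite [r]splitr; apply: ball_triangle xx' _.
by apply: le_ball x'y; exact: ltW.
Unshelve. all: by end_near.
Qed.

(** The [i]-th marginal of a product of binomial laws: after distributing, every factor other than
    the [i]-th sums to 1. *)
Lemma sum_ffun_bweight (d n : nat) (z : 'I_d -> R) (i : 'I_d) (g : nat -> R) :
  \sum_(k : {ffun 'I_d -> 'I_n.+1}) (\prod_j bweight n (k j) (z j)) * g (k i) =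
  \sum_(k < n.+1) bweight n k (z i) * g k.
Proof.
transitivity (\sum_(k : {ffun 'I_d -> 'I_n.+1}) \prod_j
    (bweight n (k j) (z j) * (if j == i then g (k j) else 1))).
  apply: eq_bigr => k _; rewrite big_split/=; congr (_ * _).
  by rewrite (bigD1 i)//= eqxx big1 ?mulr1// => j /negbTE ->.
rewrite -(bigA_distr_bigA (fun j (k : 'I_n.+1) =>
  bweight n k (z j) * (if j == i then g k else 1))).
rewrite (bigD1 i)//= eqxx [X in _ * X = _]big1 ?mulr1// => j /negbTE ->.
by under eq_bigr do rewrite mulr1; exact: bweight_sum1.
Qed.

Lemma sum_ffun_bweight1 (d n : nat) (z : 'I_d -> R) :
  \sum_(k : {ffun 'I_d -> 'I_n.+1}) (\prod_j bweight n (k j) (z j)) = 1.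
Proof.
rewrite -(bigA_distr_bigA (fun j (k : 'I_n.+1) => bweight n k (z j))).
by rewrite big1// => j _; exact: bweight_sum1.
Qed.

(* Bernstein approximation in the bounded coordinates
   [z_i = (1 + sin (x_i / L)) / 2], which are injective for [|x_i| <= K] when
   [L = 2 K]; outside this cube the error is at most [2 M]. *)
Lemma trigpoly_approx (d : nat) (phi : 'rV[R]_d -> R) (M e : R) :
  continuous phi -> (forall x, `|phi x| <= M) -> 0 < e ->
  exists2 Q, trigpoly Q &
    forall x, `|phi x - Q x| <= e * (1 + \sum_i x ord0 i ^+ 2).
Proof.
move=> cphi phiM e0.
have M0 : 0 <= M by apply: le_trans (phiM 0).
(* With this [K], [2 M <= e K <= e K^2], so that outside the cube the trivial error [2 M] is at most
   [e x_i^2] for some [i]. *)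
pose K := 1 + 2 * M / e; pose L := 2 * K.
have K1 : 1 <= K by rewrite lerDl divr_ge0 ?mulr_ge0// ltW.
have K0 : 0 < K by lra.
have L0 : 0 < L by rewrite /L mulr_gt0.
have KM : 2 * M <= e * K ^+ 2.
  apply: (@le_trans _ _ (e * K)).
    rewrite (_ : e * K = e + 2 * M) ?lerDr ?ltW//.
    by rewrite /K; field; rewrite gt_eqF.
  by rewrite ler_pM2l// expr2 ler_peMl// ltW.
pose A := [set v : 'rV[R]_d | forall i, v ord0 i \in `[(- K), K]].
have cA : compact A.
  apply: (@rV_compact _ _ (fun=> `[(- K), K]%classic)).
  by move=> _; exact: segment_compact.
have [r r0 hr] := continuous_uniform_on_compact cphi cA (divr_gt0 e0 (ltr0Sn R 1)).
have [c c0 hc] := sin_gap (divr_gt0 r0 L0).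
(* Large enough for the Chebyshev term [2 M d / (c n)] obtained at the end to be at most [e / 2]. *)
pose n := (Num.truncn (16 * M * d%:R / (c * e))).+1.
have n0 : 0 < n%:R :> R by rewrite ltr0n.
have hn : 2 * M / c * d%:R / n%:R <= e / 2.
  have : 16 * M * d%:R / (c * e) < n%:R by exact: truncnS_gt.
  rewrite ltr_pdivrMr ?mulr_gt0// => h.
  rewrite ler_pdivrMr// mulrAC ler_pdivrMr//.
  have : 0 <= M * d%:R by rewrite mulr_ge0.
  by lra.
(* [node k] is a point whose coordinate [z] below equals [k / n]. *)
pose node k : R := L * asin (2 * k%:R / n%:R - 1).
pose z (x : 'rV[R]_d) i := 2^-1 * (1 + sin (L^-1 * x ord0 i)).
have z01 x i : 0 <= z x i <= 1.
  rewrite /z; have := sin_geN1 (L^-1 * x ord0 i).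
  by have := sin_le1 (L^-1 * x ord0 i); lra.
pose W x (k : {ffun 'I_d -> 'I_n.+1}) := \prod_j bweight n (k j) (z x j).
have W0 x k : 0 <= W x k by apply: prodr_ge0 => j _; exact: bweight_ge0.
pose pt (k : {ffun 'I_d -> 'I_n.+1}) := \row_i node (k i) : 'rV[R]_d.
exists (fun x => \sum_k W x k * phi (pt k)).
  apply: trigpoly_sum => k; under eq_fun do rewrite mulrC.
  apply: trigpoly_scale; apply: trigpoly_prod => j; apply: trigpoly_bweight.
  apply: trigpoly_scale; apply: trigpoly_add; first exact: trigpoly_cst.
  exact: trigpoly_sin_coord.
move=> x; have sx0 : 0 <= \sum_i x ord0 i ^+ 2.
  by apply: sumr_ge0 => i _; exact: sqr_ge0.
have {1}-> : phi x = \sum_k W x k * phi x.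
  by rewrite -mulr_suml sum_ffun_bweight1 mul1r.
rewrite -sumrB (le_trans (ler_norm_sum _ _ _))//.
under eq_bigr do rewrite -mulrBr normrM (ger0_norm (W0 _ _)).
have phi2M y w : `|phi y - phi w| <= 2 * M.
  rewrite (le_trans (ler_normB _ _))//.
  by have := phiM y; have := phiM w; lra.
have [Ax|] := pselect (A x); last first.
  move=> /existsNP[i] /negP; rewrite in_itv/= -ler_norml -ltNge => Kx.
  apply: (@le_trans _ _ (\sum_k W x k * (2 * M))).
    by apply: ler_sum => k _; rewrite ler_wpM2l.
  rewrite -mulr_suml sum_ffun_bweight1 mul1r (le_trans KM)// ler_pM2l//.
  rewrite (bigD1 i)//= addrCA -[leLHS]addr0 lerD//.
    by rewrite -[leRHS]real_normK ?num_real// lerXn2r ?nnegrE// ltW.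
  by rewrite addr_ge0//; apply: sumr_ge0 => j _; exact: sqr_ge0.
(* Chebyshev's argument, pointwise in [k]: a node within [r] of [x] costs at most [e / 2]; for any
   other node some coordinate is off by at least [r], and [sin_gap] makes the corresponding term of
   the sum at least 1, so the sum times [2 M] covers the trivial error. *)
have main k : `|phi x - phi (pt k)| <=
    e / 2 + 2 * M * \sum_i 4 / c * (z x i - (k i)%:R / n%:R) ^+ 2.
  have S0 : 0 <= \sum_i 4 / c * (z x i - (k i)%:R / n%:R) ^+ 2.
    by apply: sumr_ge0 => i _; rewrite mulr_ge0 ?sqr_ge0// divr_ge0// ltW.
  have [/(hr _ _ Ax) h|nb] := pselect (ball x r (pt k)).
    by rewrite (le_trans h)// lerDl mulr_ge0// mulr_ge0.
  rewrite (le_trans (phi2M _ _))// -[leLHS]add0r lerD ?divr_ge0 ?(ltW e0)//.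
  rewrite ler_peMr ?mulr_ge0//.
  have [i hi] : exists i, r <= `|x ord0 i - node (k i)|.
    apply: contrapT => /forallNP h; apply: nb; split => // i j.
    rewrite (ord1 i) /pt mxE; rewrite /ball/=.
    by rewrite ltNge; apply/negP/h.
  have kn : -1 <= 2 * (k i)%:R / n%:R - 1 :> R /\ 2 * (k i)%:R / n%:R - 1 <= 1 :> R.
    have : (k i)%:R / n%:R <= (1 : R).
      by rewrite ler_pdivrMr// mul1r ler_nat -ltnS.
    have : 0 <= (k i)%:R / n%:R :> R by rewrite divr_ge0.
    by rewrite -mulrA; move: (_ / _) => q q0 q1; split; lra.
  move/andP: kn => kn.
  have Li : 0 < L^-1 by rewrite invr_gt0.
  have {}hc : c <= (sin (L^-1 * x ord0 i) - (2 * (k i)%:R / n%:R - 1)) ^+ 2.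
    rewrite -[2 * (k i)%:R / n%:R - 1]asinK ?in_itv//=; apply: hc.
    - rewrite normrM gtr0_norm// mulrC ler_pdivrMr// /L mulrA mulVf// mul1r.
      by have := Ax i; rewrite in_itv/= -ler_norml.
    - by rewrite ler_norml asin_geNpi2// asin_lepi2.
    - rewrite ler_pdivrMr// mulrC -[L in L * _]gtr0_norm// -normrM mulrBr.
      by rewrite mulrA divff ?gt_eqF// mul1r.
  rewrite (bigD1 i)//= -[leLHS]addr0 lerD//; last first.
    by apply: sumr_ge0 => j _; rewrite mulr_ge0 ?sqr_ge0// divr_ge0// ltW.
  rewrite mulrAC ler_pdivlMr// mul1r (le_trans hc)// /z.
  by rewrite le_eqVlt; apply/orP; left; apply/eqP; field; rewrite gt_eqF.
apply: (@le_trans _ _ (\sum_k W x k *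
    (e / 2 + 2 * M * \sum_i 4 / c * (z x i - (k i)%:R / n%:R) ^+ 2))).
  by apply: ler_sum => k _; rewrite ler_wpM2l.
under eq_bigr do rewrite mulrDr.
rewrite big_split/= -mulr_suml sum_ffun_bweight1 mul1r.
rewrite mulrDr mulr1 -[leLHS]addr0 lerD ?mulr_ge0 ?(ltW e0)//.
rewrite [leRHS]splitr lerD//.
apply: le_trans hn.
under eq_bigr do rewrite mulrCA mulr_sumr.
rewrite -mulr_sumr exchange_big/=.
under eq_bigr do under eq_bigr do rewrite mulrCA.
under eq_bigr => i _ do rewrite -mulr_sumr
  (sum_ffun_bweight n (z x) i (fun m => (z x i - m%:R / n%:R) ^+ 2)) bweight_var//.
rewrite -!mulrA ler_pM2l// ler_wpM2l//.
apply: (@le_trans _ _ (\sum_(i < d) c^-1 / n%:R)); last first.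
  rewrite sumr_const card_ord -[_ *+ d]mulr_natr le_eqVlt; apply/orP; left.
  by apply/eqP; field; rewrite !gt_eqF.
apply: ler_sum => i _; rewrite mulrA ler_pM2r ?invr_gt0//.
rewrite mulrAC -[leRHS]mul1r ler_pM2r ?invr_gt0//.
(* [z (1 - z) <= 1 / 4] cancels the factor 4. *)
by have := sqr_ge0 (2 * z x i - 1); lra.
Qed.

End trig_approx.

(** * Integrability, and expectations of functions of a random vector *)

Section integrable_real.
Context d (T : measurableType d) (R : realType) (mu : {measure set T -> \bar R}).
Variables (D : set T) (mD : measurable D).
Implicit Types f g : T -> R.

Lemma integrableRD f g : mu.-integrable D (EFin \o f) ->
  mu.-integrable D (EFin \o g) ->
  mu.-integrable D (EFin \o (fun x => f x + g x)).
Proof. by move=> fi gi; exact: (integrableD mD fi gi). Qed.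

Lemma integrableRB f g : mu.-integrable D (EFin \o f) ->
  mu.-integrable D (EFin \o g) ->
  mu.-integrable D (EFin \o (fun x => f x - g x)).
Proof. by move=> fi gi; exact: (integrableB mD fi gi). Qed.

Lemma integrableRZ a f : mu.-integrable D (EFin \o f) ->
  mu.-integrable D (EFin \o (fun x => a * f x)).
Proof. by move=> fi; exact: (integrableZl mD _ fi). Qed.

Lemma integrableRsum (I : Type) (s : seq I) (f : I -> T -> R) :
  (forall i, mu.-integrable D (EFin \o f i)) ->
  mu.-integrable D (EFin \o (fun x => \sum_(i <- s) f i x)).
Proof.
move=> fi; rewrite (_ : EFin \o _ = fun x => \sum_(i <- s) (f i x)%:E)%E.
  by apply: integrable_sum => // i _; exact: fi.
by apply/funext => w; rewrite /= sumEFin.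
Qed.

Lemma Rintegral_sum (I : Type) (s : seq I) (f : I -> T -> R) :
  (forall i, mu.-integrable D (EFin \o f i)) ->
  \int[mu]_(x in D) (\sum_(i <- s) f i x) = \sum_(i <- s) \int[mu]_(x in D) f i x.
Proof.
move=> fi; elim: s => [|i s IH].
  by under eq_Rintegral do rewrite big_nil; rewrite Rintegral_cst// mul0r big_nil.
under eq_Rintegral do rewrite big_cons.
rewrite big_cons RintegralD ?IH//; exact: integrableRsum.
Qed.

End integrable_real.

Section bounded.
Context d (T : measurableType d) (R : realType) (P : probability T R).

Lemma bounded_integrable (f : T -> R) (M : R) :
  measurable_fun setT f -> (forall x, `|f x| <= M) ->
  P.-integrable setT (EFin \o f).
Proof.
move=> mf fM; apply: measurable_bounded_integrable => //.
  by rewrite -ge0_fin_numE// fin_num_measure.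
exists M; split; first exact: num_real.
by move=> N MN x _ /=; rewrite (le_trans (fM x))// ltW.
Qed.

Lemma expectationE (f : T -> R) : P.-integrable setT (EFin \o f) ->
  ('E_P[f])%E = (\int[P]_x f x)%:E.
Proof.
by move=> fi; rewrite unlock /Rintegral fineK//; exact: integrable_fin_num.
Qed.

Lemma sqr_integrable (f : T -> R) (C : R) : measurable_fun setT f ->
  ('E_P[fun x => (f x ^+ 2)%R] <= C%:E)%E ->
  P.-integrable setT (EFin \o (fun x => f x ^+ 2)).
Proof.
move=> mf fC; apply/integrableP; split.
  by apply/measurable_EFinP; exact: measurable_funX.
under eq_integral do rewrite /= ger0_norm ?sqr_ge0//.
by rewrite unlock in fC; rewrite (le_lt_trans fC)// ltry.
Qed.

End bounded.

Section trigpoly_rv.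
Context d (T : measurableType d) (R : realType) (P : probability T R) (n : nat).
Variable X : T -> 'rV[R]_n.
Hypothesis mX : forall i, measurable_fun setT (fun w => X w ord0 i).

Lemma measurable_lincomb (u : 'I_n -> R) :
  measurable_fun setT (fun w => \sum_i u i * X w ord0 i).
Proof. by apply: measurable_sum => i; apply: measurable_funM. Qed.

Lemma measurable_trigpoly Q : trigpoly Q -> measurable_fun setT (Q \o X).
Proof.
elim=> {Q} [u b|f g _ IHf _ IHg|a f _ IH].
- apply: measurableT_comp; first by apply: continuous_measurable_fun; exact: continuous_cos.
  by apply: measurable_funD => //; exact: measurable_lincomb.
- exact: measurable_funD.
- exact: measurable_funM.
Qed.

Lemma integrable_trigpoly Q : trigpoly Q -> P.-integrable setT (EFin \o (Q \o X)).
Proof.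
move=> tQ; have [M QM] := trigpoly_bounded tQ.
by apply: (@bounded_integrable _ _ _ _ _ M); [exact: measurable_trigpoly|move=> x; exact: QM].
Qed.

(** Since [X] is measurable coordinate by coordinate, [phi \o X] is obtained as a pointwise limit of
    trigonometric polynomials in these coordinates, with error [(1 + |X|^2) / (k + 1)]. *)
Lemma measurable_continuous_comp (phi : 'rV[R]_n -> R) (M : R) :
  continuous phi -> (forall x, `|phi x| <= M) -> measurable_fun setT (phi \o X).
Proof.
move=> cphi phiM.
have /choice[Q hQ] k : exists Q, trigpoly Q /\
    forall x, `|phi x - Q x| <= k.+1%:R^-1 * (1 + \sum_i x ord0 i ^+ 2).
  have k0 : 0 < k.+1%:R^-1 :> R by rewrite invr_gt0.
  by have [Q] := trigpoly_approx cphi phiM k0; exists Q.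
apply: (@measurable_fun_cvg _ _ _ _ (fun k => Q k \o X)).
  by move=> k; apply: measurable_trigpoly; have [] := hQ k.
move=> w _; apply/cvgrPdist_le => e e0.
set S := 1 + \sum_i X w ord0 i ^+ 2.
have : (k.+1%:R^-1 * S) @[k --> \oo] --> (0 * S : R).
  by apply: cvgMl; exact: cvg_harmonic.
rewrite mul0r => /cvgrPdist_le/(_ _ e0); apply: filterS => k /=.
rewrite sub0r normrN => h; rewrite (le_trans ((hQ k).2 _))//.
by rewrite (le_trans _ h)// ler_norm.
Qed.

Lemma Rintegral_trigpoly_approx (phi Q : 'rV[R]_n -> R) (M C e : R) :
  continuous phi -> (forall x, `|phi x| <= M) -> trigpoly Q -> 0 <= e ->
  (forall x, `|phi x - Q x| <= e * (1 + \sum_i x ord0 i ^+ 2)) ->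
  (forall i, 'E_P[fun w => (X w ord0 i ^+ 2)%R] <= C%:E)%E ->
  `|\int[P]_w phi (X w) - \int[P]_w Q (X w)| <= e * (1 + n%:R * C).
Proof.
move=> cphi phiM tQ e0 phiQ XC.
have iphi : P.-integrable setT (EFin \o (phi \o X)).
  apply: (@bounded_integrable _ _ _ _ _ M) => //.
    exact: measurable_continuous_comp phiM.
  by move=> x; exact: phiM.
have iQ := integrable_trigpoly tQ.
have iX i : P.-integrable setT (EFin \o (fun w => (X w ord0 i) ^+ 2)).
  exact: sqr_integrable (XC i).
have i1 : P.-integrable setT (EFin \o (fun=> 1 : R)).
  by apply: (@bounded_integrable _ _ _ _ _ 1) => // x; rewrite normr1.
have iS := integrableRsum measurableT (index_enum 'I_n) iX.
rewrite -RintegralB// (le_trans (le_normr_Rintegral _ _))//.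
  exact: integrableRB.
apply: (@le_trans _ _ (\int[P]_w (e * (1 + \sum_i (X w ord0 i) ^+ 2)))).
  apply: le_Rintegral => //.
  - by apply: integrable_norm; exact: integrableRB.
  - by apply: integrableRZ => //; exact: integrableRD.
rewrite RintegralZl//; last exact: integrableRD.
rewrite ler_wpM2l// RintegralD// Rintegral_cst// mul1r lerD//.
  by rewrite (_ : fine _ = 1)//; exact: (congr1 fine (probability_setT P)).
rewrite Rintegral_sum// mulr_natl -[n in _ *+ n]card_ord -sumr_const.
by apply: ler_sum => i _; rewrite -lee_fin -expectationE.
Qed.

End trigpoly_rv.

Section cvg_in_law.
Context d d' (T : measurableType d) (T' : measurableType d') (R : realType)
  (P : probability T R) (P' : probability T' R) (n : nat).
Variables (X : R -> T -> 'rV[R]_n) (Y : T' -> 'rV[R]_n) (C : R).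
Hypothesis mX : forall eps i, measurable_fun setT (fun w => X eps w ord0 i).
Hypothesis mY : forall i, measurable_fun setT (fun w => Y w ord0 i).
Hypothesis XC : \forall eps \near 0^'+, forall i,
  ('E_P[fun w => (X eps w ord0 i ^+ 2)%R] <= C%:E)%E.
Hypothesis YC : forall i, ('E_P'[fun w => (Y w ord0 i ^+ 2)%R] <= C%:E)%E.
Hypothesis cos_cvg : forall (u : 'I_n -> R) b,
  \int[P]_w cos (\sum_i u i * X eps w ord0 i + b) @[eps --> 0^'+] -->
  \int[P']_w cos (\sum_i u i * Y w ord0 i + b).

Lemma trigpoly_cvg Q : trigpoly Q ->
  \int[P]_w Q (X eps w) @[eps --> 0^'+] --> \int[P']_w Q (Y w).
Proof.
have iX f eps : trigpoly f ->
    P.-integrable setT (EFin \o (fun w => f (X eps w))).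
  by move=> tf; exact: (integrable_trigpoly P (mX eps) tf).
have iY f : trigpoly f -> P'.-integrable setT (EFin \o (fun w => f (Y w))).
  by move=> tf; exact: (integrable_trigpoly P' mY tf).
elim=> {Q} [u b|f g tf IHf tg IHg|a f tf IH]; first exact: cos_cvg.
- rewrite RintegralD//; [|exact: iY|exact: iY].
  under eq_fun => eps do rewrite (RintegralD _ (iX _ eps tf) (iX _ eps tg))//.
  exact: cvgD.
- rewrite RintegralZl//; last exact: iY.
  under eq_fun => eps do rewrite (RintegralZl _ _ (iX _ eps tf))//.
  exact: cvgMr.
Qed.

Lemma cvg_in_law_of_cos : cvg_in_law_at_right0 P P' X Y.
Proof.
move=> phi cphi [M phiM].
have iphi d0 (T0 : measurableType d0) (P0 : probability T0 R)
      (Z : T0 -> 'rV[R]_n) :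
    (forall i, measurable_fun setT (fun w => Z w ord0 i)) ->
    P0.-integrable setT (EFin \o (phi \o Z)).
  move=> mZ; apply: (@bounded_integrable _ _ _ _ _ M) => //.
    exact: measurable_continuous_comp phiM.
  by move=> x; exact: phiM.
under eq_fun => eps do rewrite (expectationE (iphi _ _ _ _ (mX eps))).
rewrite (expectationE (iphi _ _ _ _ mY)).
apply: cvg_EFin; first by apply: nearW.
apply/cvgrPdist_le => e e0 /=.
(* For [n = 0] nothing forces [C] to be nonnegative, hence the absolute value. *)
pose D := 1 + n%:R * `|C|.
have D0 : 0 < D by rewrite ltr_pwDl// mulr_ge0.
have CD : 1 + n%:R * C <= D by rewrite lerD2l ler_wpM2l// ler_norm.
have eD : 0 < e / (3 * D) by rewrite divr_gt0// mulr_gt0.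
have eDD : e / (3 * D) * D = e / 3 by field; rewrite gt_eqF.
have [Q tQ phiQ] := trigpoly_approx cphi phiM eD.
have e3 : 0 < e / 3 by rewrite divr_gt0.
have /cvgrPdist_le/(_ _ e3) hQ := trigpoly_cvg tQ.
near=> eps.
have hX : `|\int[P]_w phi (X eps w) - \int[P]_w Q (X eps w)| <= e / 3.
  rewrite -eDD; apply: le_trans (ler_wpM2l (ltW eD) CD).
  by apply: (Rintegral_trigpoly_approx (mX eps) cphi phiM tQ (ltW eD) phiQ); near: eps.
have hY : `|\int[P']_w phi (Y w) - \int[P']_w Q (Y w)| <= e / 3.
  rewrite -eDD; apply: le_trans (ler_wpM2l (ltW eD) CD).
  exact: (Rintegral_trigpoly_approx mY cphi phiM tQ (ltW eD) phiQ).
have hXY : `|\int[P']_w Q (Y w) - \int[P]_w Q (X eps w)| <= e / 3.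
  by near: eps.
rewrite (_ : e = e / 3 + e / 3 + e / 3); last by field.
rewrite (le_trans (ler_distD (\int[P]_w Q (X eps w)) _ _))//.
rewrite lerD//; last by rewrite distrC.
by rewrite (le_trans (ler_distD (\int[P']_w Q (Y w)) _ _))// lerD.
Unshelve. all: by end_near. Qed.

End cvg_in_law.

(** * Gaussian characteristic functions *)

Section improper_FTC.
Context {R : realType}.
Local Notation mu := (@lebesgue_measure R).

(** Over [[-(n + 1), n + 1]] the integral is an increment of [G], which vanishes in the limit;
    dominated convergence with bound [|g|] identifies this limit with the integral over the line. *)
Lemma Rintegral_derive_eq0 (G g : R -> R) :
  (forall x : R, is_derive x 1 G (g x)) -> continuous g ->
  mu.-integrable setT (EFin \o g) ->
  G n.+1%:R @[n --> \oo] --> 0 -> G (- n.+1%:R) @[n --> \oo] --> 0 ->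
  \int[mu]_x g x = 0.
Proof.
move=> dG cg ig Gy GNy.
have cG : continuous G.
  by move=> x; apply/differentiable_continuous/derivable1_diffP; have [] := dG x.
pose D n := `[- n.+1%:R, n.+1%:R]%classic : set R.
have FTC n : (\int[mu]_(x in D n) (g x)%:E)%E =
    (G n.+1%:R - G (- n.+1%:R))%:E.
  rewrite EFinB; apply: continuous_FTC2.
  - by rewrite (@lt_trans _ _ 0) ?oppr_lt0 ?ltr0n.
  - exact: continuous_subspaceT.
  - split => [x _| |]; first by have [] := dG x.
    + by apply: cvg_at_right_filter; exact: cG.
    + by apply: cvg_at_left_filter; exact: cG.
  - by move=> x _; rewrite derive1E; have [_ ->] := dG x.
have mg : measurable_fun setT (EFin \o g) := measurable_int _ ig.
have [] := @dominated_convergence _ _ _ mu setT measurableT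
  (fun n => (EFin \o g) \_ (D n)) (EFin \o g) (abse \o (EFin \o g)).
- move=> n; apply/(measurable_restrictT _ _).1 => //; first exact: measurable_itv.
  exact: measurable_funTS.
- by [].
- apply: aeW => x _; apply: cvg_near_cst.
  near=> n; rewrite patchE ifT// inE /D/= in_itv/= -ler_norml.
  near: n; apply: filterS (nbhs_infty_ger `|x|) => n xn.
  by rewrite (le_trans xn)// ler_nat.
- exact: integrable_abse.
- apply: aeW => x n _; rewrite patchE; case: ifPn => // _.
  by rewrite abse0 abse_ge0.
move=> _ _.
under eq_fun do rewrite -integral_mkcond/= FTC.
move=> h; have : (G n.+1%:R - G (- n.+1%:R))%:E @[n --> \oo] --> (0 - 0)%:E.
  by apply: cvg_EFin; [exact: nearW|apply: cvgB].
by move/(cvg_unique _ h) => hg; rewrite /Rintegral hg/= ?subr0.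
Unshelve. all: by end_near. Qed.

End improper_FTC.

Section normal_moments.
Context {R : realType} (s : R).
Hypothesis s0 : s != 0.
Local Notation mu := (@lebesgue_measure R).
Local Notation p := (normal_pdf 0 s).

Lemma normal_pdf0E x : p x = normal_peak s * expR (- (x ^+ 2 / (s ^+ 2 *+ 2))).
Proof. by rewrite normal_pdfE// /normal_fun subr0 mulNr. Qed.

Let s2 : 0 < s ^+ 2. Proof. by rewrite exprn_even_gt0. Qed.

Lemma is_derive_normal_pdf (x : R) : is_derive x 1 (p : R -> R) (- x / s ^+ 2 * p x).
Proof.
rewrite (_ : p = fun x => normal_peak s * expR (- (x ^+ 2 / (s ^+ 2 *+ 2)))); last first.
  by apply/funext => y; exact: normal_pdf0E.
apply: is_derive_eq.
rewrite /GRing.scale/=.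
by field.
Qed.

(** Half of the Gaussian exponent absorbs [x^2], by [y <= exp y] at [y = x^2 / (4 s^2)]; the other
    half is the exponent of the density with deviation [s sqrt 2]. This gives both the integrability
    and the boundedness of [x^2 p]. *)
Lemma sqr_normal_pdf_le x : x ^+ 2 * p x <=
  4 * s ^+ 2 * (normal_peak s / normal_peak (s * Num.sqrt 2)) *
  normal_pdf 0 (s * Num.sqrt 2) x.
Proof.
have t0 : s * Num.sqrt 2 != 0 by rewrite mulf_neq0// gt_eqF.
rewrite normal_pdf0E normal_pdfE// /normal_fun subr0.
rewrite [leLHS]mulrCA [leRHS](_ : _ = normal_peak s * (4 * s ^+ 2 *
    expR (- x ^+ 2 / ((s * Num.sqrt 2) ^+ 2 *+ 2)))).
  rewrite ler_pM2l ?normal_peak_gt0//.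
  rewrite exprMn sqr_sqrtr//.
  have -> : - (x ^+ 2 / (s ^+ 2 *+ 2)) =
     - (x ^+ 2 / (4 * s ^+ 2)) + - x ^+ 2 / ((s ^+ 2 * 2) *+ 2).
    by field.
  rewrite expRD mulrA ler_pM2r ?expR_gt0// expRN ler_pdivrMr ?expR_gt0//.
  have := expR_ge1Dx (x ^+ 2 / (4 * s ^+ 2)).
  move=> h; rewrite mulrC -ler_pdivrMr; last by rewrite mulr_gt0.
  by rewrite (le_trans _ h)// lerDr.
by field; rewrite gt_eqF// normal_peak_gt0.
Qed.

Lemma integrable_sqr_normal_pdf :
  mu.-integrable setT (EFin \o (fun x => x ^+ 2 * p x)).
Proof.
set c := 4 * s ^+ 2 * (normal_peak s / normal_peak (s * Num.sqrt 2)).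
have : mu.-integrable setT (EFin \o
    (fun x => c * normal_pdf 0 (s * Num.sqrt 2) x)).
  by apply: integrableRZ => //; exact: integrable_normal_pdf.
apply: le_integrable => //.
  apply/measurable_EFinP/measurable_funM; first exact: measurable_funX.
  exact: measurable_normal_pdf.
move=> x _; have xp : 0 <= x ^+ 2 * p x.
  by apply: mulr_ge0; [exact: sqr_ge0|exact: normal_pdf_ge0].
rewrite /= lee_fin (ger0_norm xp).
by rewrite (le_trans (sqr_normal_pdf_le x))// ler_norm.
Qed.

Lemma sqr_normal_pdf_bounded : exists2 D, 0 <= D & forall x, x ^+ 2 * p x <= D.
Proof.
have t0 : s * Num.sqrt 2 != 0 by rewrite mulf_neq0// gt_eqF.
set c := 4 * s ^+ 2 * (normal_peak s / normal_peak (s * Num.sqrt 2)).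
have c0 : 0 <= c.
  rewrite /c mulr_ge0//; first by rewrite mulr_ge0 ?sqr_ge0.
  by rewrite divr_ge0 ?normal_peak_ge0.
exists (c * normal_peak (s * Num.sqrt 2)).
  by rewrite mulr_ge0 ?normal_peak_ge0.
by move=> x; rewrite (le_trans (sqr_normal_pdf_le x))// ler_wpM2l ?normal_pdf_ub.
Qed.

(** Stein's identity: [(F p)' = f p - x F p / s^2] has integral 0. Applied to the identity it gives
    the variance, and to a sine the differential equation of the characteristic function. *)
Lemma normal_pdf_stein (F f : R -> R) (K : R) :
  (forall x : R, is_derive x 1 F (f x)) -> continuous f ->
  (forall x, `|f x| <= K) -> (forall x, `|F x| <= K * (1 + `|x|)) ->
  mu.-integrable setT (EFin \o (fun x => x * F x * p x)) /\
  \int[mu]_x (x * F x * p x) = s ^+ 2 * \int[mu]_x (f x * p x).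
Proof.
move=> dF cf fK FK.
have K0 : 0 <= K by apply: le_trans (fK 0).
have cF : continuous F.
  by move=> x; apply/differentiable_continuous/derivable1_diffP; have [] := dF x.
have mF : measurable_fun setT F by exact: continuous_measurable_fun.
have mf : measurable_fun setT f by exact: continuous_measurable_fun.
have mp : measurable_fun setT p by exact: measurable_normal_pdf.
have p0 x : 0 <= p x by exact: normal_pdf_ge0.
have x2p x : 0 <= x ^+ 2 * p x by apply: mulr_ge0 => //; exact: sqr_ge0.
have ip : mu.-integrable setT (EFin \o p) by exact: integrable_normal_pdf.
have ifp : mu.-integrable setT (EFin \o (fun x => f x * p x)).
  have : mu.-integrable setT (EFin \o (fun x => K * p x)) by exact: integrableRZ.
  apply: le_integrable => //; first exact/measurable_EFinP/measurable_funM.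
  move=> x _; rewrite /= lee_fin !normrM (ger0_norm (p0 x)) (ger0_norm K0).
  by rewrite ler_wpM2r.
have ixFp : mu.-integrable setT (EFin \o (fun x => x * F x * p x)).
  have : mu.-integrable setT (EFin \o (fun x => K * p x + (2 * K) * (x ^+ 2 * p x))).
    apply: integrableRD => //; first exact: integrableRZ.
    by apply: integrableRZ => //; exact: integrable_sqr_normal_pdf.
  apply: le_integrable => //.
    by apply/measurable_EFinP/measurable_funM => //; exact: measurable_funM.
  move=> x _; rewrite /= lee_fin !normrM (ger0_norm (p0 x)).
  have h0 : 0 <= K * p x + 2 * K * (x ^+ 2 * p x).
    by apply: addr_ge0; apply: mulr_ge0 => //; exact: mulr_ge0.
  rewrite (ger0_norm h0).
  apply: (@le_trans _ _ (`|x| * (K * (1 + `|x|)) * p x)).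
    by rewrite ler_wpM2r// ler_wpM2l.
  rewrite -(real_normK (num_real x)).
  rewrite [leRHS](_ : _ = K * (1 + 2 * `|x| ^+ 2) * p x); last by ring.
  rewrite ler_wpM2r// mulrCA ler_wpM2l//.
  by have := sqr_ge0 (`|x| - 1); have := sqr_ge0 (`|x|); lra.
split => //.
pose G x := F x * p x; pose g x := f x * p x - s ^- 2 * (x * F x * p x).
have dG (x : R) : is_derive x 1 G (g x).
  have := dF x; have := is_derive_normal_pdf x => dpx dFx.
  by rewrite /G /g; apply: is_derive_eq; rewrite /GRing.scale/=; field.
have ig : mu.-integrable setT (EFin \o g).
  by apply: integrableRB => //; exact: integrableRZ.
suff : \int[mu]_x g x = 0.
  rewrite /g RintegralB//; last exact: integrableRZ.
  rewrite RintegralZl// => /eqP; rewrite subr_eq0 => /eqP ->.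
  by rewrite mulrA divff ?mul1r// gt_eqF.
have [D D0 hD] := sqr_normal_pdf_bounded.
(* For [|x| >= 1], [|F x| <= 2 K |x|], so [|F p| <= 2 K D / |x|] with [D] a bound of [x^2 p]. The
   sequence [a] stands for both ends of the line. *)
have hG (a : R^nat) : (forall n, `|a n| = n.+1%:R) -> G (a n) @[n --> \oo] --> 0.
  move=> an; apply/norm_cvg0P.
  have h : 2 * K * D * n.+1%:R^-1 @[n --> \oo] --> (0 : R).
    by rewrite -(mulr0 (2 * K * D)); apply: cvgMr; exact: cvg_harmonic.
  apply: (squeeze_cvgr _ (cvg_cst 0) h).
  apply: nearW => n; rewrite normr_ge0/=.
  have a0 : 0 < `|a n| by rewrite an ltr0n.
  have a1 : 1 <= `|a n| by rewrite an ler1n.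
  rewrite -(an n) ler_pdivlMr// /G normrM (ger0_norm (p0 _)).
  apply: (@le_trans _ _ (2 * K * ((a n) ^+ 2 * p (a n)))).
    rewrite -(real_normK (num_real (a n))) expr2 mulrAC.
    rewrite [leRHS](_ : _ = 2 * K * `|a n| * `|a n| * p (a n)); last by ring.
    rewrite ler_wpM2r// ler_wpM2r// (le_trans (FK _))//.
    by rewrite (mulrC 2) -mulrA ler_wpM2l//; lra.
  by rewrite ler_wpM2l ?mulr_ge0.
apply: (Rintegral_derive_eq0 dG) => //.
- move=> x; apply: cvgB; first by apply: cvgM; [exact: cf|exact: continuous_normal_pdf].
  apply: cvgMr; apply: cvgM; last exact: continuous_normal_pdf.
  by apply: cvgM => //; exact: cF.
- by apply: hG => n; rewrite ger0_norm.
- by apply: hG => n; rewrite normrN ger0_norm.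
Qed.

Lemma normal_pdf_sqr : \int[mu]_x (x ^+ 2 * p x) = s ^+ 2.
Proof.
have [|||_] := @normal_pdf_stein id (fun=> 1) 1.
- by move=> x; exact: cvg_cst.
- by move=> _; rewrite normr1.
- by move=> x; rewrite mul1r lerDr.
under eq_Rintegral do rewrite -expr2.
under [in RHS]eq_Rintegral do rewrite mul1r.
by rewrite [X in _ = _ * X -> _]/Rintegral integral_normal_pdf mulr1.
Qed.

(** Differentiation under the integral, dominated through [|x| <= 1 + x^2], followed by Stein's
    identity yields [phi' v = - v s^2 phi v]. Hence [exp (v^2 s^2 / 2) phi v] is constant, and at
    [v = 0] it equals [cos b]. *)
Lemma normal_pdf_cos (u b : R) :
  \int[mu]_x (cos (u * x + b) * p x) = expR (- (u ^+ 2 * s ^+ 2 / 2)) * cos b.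
Proof.
pose phi v := \int[mu]_x (cos (v * x + b) * p x).
have mp : measurable_fun setT p by exact: measurable_normal_pdf.
have p0 x : 0 <= p x by exact: normal_pdf_ge0.
have ip : mu.-integrable setT (EFin \o p) by exact: integrable_normal_pdf.
have mcos (v : R) : measurable_fun setT (fun x : R => cos (v * x + b)).
  apply: measurableT_comp.
    by apply: continuous_measurable_fun; exact: continuous_cos.
  by apply: measurable_funD => //; exact: measurable_funM.
have icos (v : R) : mu.-integrable setT (EFin \o (fun x => cos (v * x + b) * p x)).
  apply: le_integrable ip => //.
    by apply/measurable_EFinP; apply: measurable_funM; [exact: mcos|exact: mp].
  by move=> x _; rewrite /= lee_fin normrM ler_piMl//; exact: cos_max.
have dphi (v : R) : is_derive v 1 phi (- (v * s ^+ 2) * phi v).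
  pose f (u x : R) := cos (u * x + b) * p x.
  have df (w x : R) : is_derive w 1 (f ^~ x) (- (x * sin (w * x + b) * p x)).
    by rewrite /f; apply: is_derive_eq; rewrite /GRing.scale/=; ring.
  have d1f w x : partial1of2 f w x = - (x * sin (w * x + b) * p x).
    by rewrite /partial1of2 derive1E; have [_ ->] := df w x.
  pose G x := p x + x ^+ 2 * p x.
  have G0 x : 0 <= G x by rewrite addr_ge0// mulr_ge0// sqr_ge0.
  have iG : mu.-integrable setT (EFin \o G).
    by apply: integrableRD => //; exact: integrable_sqr_normal_pdf.
  have Iv : `]v - 1, v + 1[%classic v by rewrite /= in_itv/=; lra.
  have intf x : `]v - 1, v + 1[%classic x -> mu.-integrable setT (EFin \o f x).
    by move=> _; exact: icos.
  have derf x y : `]v - 1, v + 1[%classic x -> setT y -> derivable (f ^~ y) x 1.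
    by move=> _ _; have [] := df x y.
  have ubf x y : `]v - 1, v + 1[%classic x -> setT y -> `|partial1of2 f x y| <= G y.
    move=> _ _; rewrite d1f normrN !normrM (ger0_norm (p0 _)) /G.
    rewrite [leRHS](_ : _ = (1 + y ^+ 2) * p y); last by ring.
    rewrite ler_wpM2r//.
    apply: (@le_trans _ _ (`|y| * 1)); first by rewrite ler_wpM2l// sin_max.
    rewrite -(real_normK (num_real y)).
    by have := sqr_ge0 (`|y| - 1); have := sqr_ge0 (`|y|); lra.
  apply: DeriveDef.
    exact: (@derivable_under_integral _ _ _ mu f setT measurableT _ _ _ Iv intf derf G G0 iG ubf).
  rewrite -derive1E.
  rewrite (@differentiation_under_integral _ _ _ mu f setT measurableT _ _ _ Iv intf derf G G0 iG ubf).
  under eq_Rintegral do rewrite d1f -mulN1r.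
  have [||||ixs hs] := @normal_pdf_stein (fun x => sin (v * x + b))
    (fun x => v * cos (v * x + b)) (1 + `|v|).
  - move=> x; apply: is_derive_eq; rewrite /GRing.scale/=; ring.
  - move=> x; apply: cvgMr; apply: continuous_comp; last exact: continuous_cos.
    by apply: cvgD; [exact: cvgMr|exact: cvg_cst].
  - by move=> x; rewrite normrM -[leRHS]mulr1 ler_pM// ?cos_max// lerDr.
  - move=> x; rewrite (le_trans (sin_max _))//.
    by rewrite -[leLHS]mulr1 ler_pM// ?lerDl.
  rewrite RintegralZl// hs mulN1r.
  under eq_Rintegral do rewrite -mulrA.
  by rewrite RintegralZl//= /phi; ring.
suff h (v : R) : expR (v ^+ 2 * s ^+ 2 / 2) * phi v = cos b.
  by rewrite -(h u) mulrA -expRD addNr expR0 mul1r.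
transitivity (expR (0 ^+ 2 * s ^+ 2 / 2) * phi 0); last first.
  rewrite expr0n/= !mul0r expR0 mul1r /phi.
  under eq_Rintegral do rewrite mul0r add0r.
  by rewrite RintegralZl// /Rintegral integral_normal_pdf mulr1.
apply: (@is_derive_0_is_cst _ (fun v => expR (v ^+ 2 * s ^+ 2 / 2) * phi v)) => w.
have := dphi w => ?.
by apply: is_derive_eq; rewrite /GRing.scale/=; field.
Qed.

End normal_moments.

Section centered_gaussian.
Context {R : realType}.
Local Notation mu := (@lebesgue_measure R).

(** The change of variables goes through the Radon-Nikodym derivative of [normal_prob], which agrees
    almost everywhere with [normal_pdf] because both have the same integral over every measurable
    set. *)
Lemma ge0_integral_normal_prob (m s : R) (f : R -> \bar R) :
  measurable_fun setT f -> (forall x, 0 <= f x)%E ->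
  (\int[normal_prob m s]_x f x = \int[mu]_x (f x * (normal_pdf m s x)%:E))%E.
Proof.
move=> mf f0; have dom := normal_prob_dominates m s.
rewrite -(Radon_Nikodym_SigmaFinite.change_of_variables dom f0 measurableT mf).
have RNi := Radon_Nikodym_SigmaFinite.f_integrable dom.
have mp : measurable_fun setT (EFin \o normal_pdf m s).
  by apply/measurable_EFinP; exact: measurable_normal_pdf.
apply: ae_eq_integral => //.
- by apply: emeasurable_funM => //; exact: measurable_int RNi.
- exact: emeasurable_funM.
- apply: ae_eqe_mul2l => /=; apply: integral_ae_eq => //.
  by move=> E _ mE; rewrite -Radon_Nikodym_SigmaFinite.f_integral.
Qed.

Context d (T : measurableType d) (P : probability T R) (Y : T -> R) (v : R).
Hypothesis mY : measurable_fun setT Y.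
Hypothesis v0 : 0 <= v.
Hypothesis lawY : forall A, measurable A ->
  P [set w | A (Y w)] = centered_gaussian v A.

Lemma ge0_integral_centered_gaussian (f : R -> R) :
  measurable_fun setT f -> (forall x, 0 <= f x) ->
  (\int[P]_w (f (Y w))%:E = if v == 0%R then (f 0%R)%:E else
    \int[mu]_x (f x * normal_pdf 0 (Num.sqrt v) x)%:E)%E.
Proof.
move=> mf f0.
have mf' : measurable_fun setT (EFin \o f) by exact/measurable_EFinP.
have f0' x : (0 <= (EFin \o f) x)%E by rewrite lee_fin.
pose mY' := isMeasurableFun.Build _ _ T (measurableTypeR R) Y mY.
pose Y' : {RV P >-> measurableTypeR R} := HB.pack (Y : T -> measurableTypeR R) mY'.
rewrite -[LHS](ge0_integral_distribution Y' mf' f0').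
have [v00|v00] := eqVneq v 0.
  transitivity (\int[\d_(0%R : measurableTypeR R)]_y (EFin \o f) y)%E.
    apply: eq_measure_integral => A mA _.
    by have := lawY mA; rewrite /centered_gaussian v00 eqxx.
  by rewrite integral_dirac// diracT mul1e.
transitivity (\int[normal_prob 0%R (Num.sqrt v)]_y (EFin \o f) y)%E.
  apply: eq_measure_integral => A mA _.
  by have := lawY mA; rewrite /centered_gaussian (negbTE v00).
exact: (ge0_integral_normal_prob 0 (Num.sqrt v) mf' f0').
Qed.

Lemma centered_gaussian_sqr : ('E_P[fun w => (Y w ^+ 2)%R] = v%:E)%E.
Proof.
rewrite unlock.
rewrite (@ge0_integral_centered_gaussian (fun x => x ^+ 2)).
- case: ifPn => [/eqP ->|v00]; first by rewrite expr0n.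
  have s0 : Num.sqrt v != 0 by rewrite sqrtr_eq0 -ltNge lt_neqAle eq_sym v00.
  rewrite -[v in RHS](sqr_sqrtr v0) -(normal_pdf_sqr s0) /Rintegral fineK//.
  by apply: integrable_fin_num => //; exact: integrable_sqr_normal_pdf.
- exact: measurable_funX.
- by move=> x; exact: sqr_ge0.
Qed.

Lemma centered_gaussian_cos (u b : R) :
  \int[P]_w cos (u * Y w + b) = expR (- (u ^+ 2 * v / 2)) * cos b.
Proof.
have mcos : measurable_fun setT (fun x : R => cos (u * x + b)).
  apply: measurableT_comp.
    by apply: continuous_measurable_fun; exact: continuous_cos.
  by apply: measurable_funD => //; exact: measurable_funM.
have i1 : P.-integrable setT (EFin \o (fun=> 1 : R)).
  by apply: (@bounded_integrable _ _ _ _ _ 1) => // x; rewrite normr1.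
have ic : P.-integrable setT (EFin \o (fun w => cos (u * Y w + b))).
  apply: (@bounded_integrable _ _ _ _ _ 1).
    exact: measurableT_comp mcos mY.
  by move=> w; exact: cos_max.
(* The transfer to the density is stated for nonnegative integrands, hence the shift by 1. *)
have : \int[P]_w (1 + cos (u * Y w + b)) =
    1 + expR (- (u ^+ 2 * v / 2)) * cos b.
  rewrite {1}/Rintegral.
  rewrite (@ge0_integral_centered_gaussian (fun x => 1 + cos (u * x + b))).
  - case: ifPn => [/eqP ->|v00].
      by rewrite mulr0 add0r mulr0 mul0r oppr0 expR0 mul1r.
    have s0 : Num.sqrt v != 0 by rewrite sqrtr_eq0 -ltNge lt_neqAle eq_sym v00.
    rewrite -[v in RHS](sqr_sqrtr v0) -(normal_pdf_cos s0).
    rewrite -/(Rintegral _ _ _); under eq_Rintegral do rewrite mulrDl mul1r.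
    have ip := integrable_normal_pdf 0 (Num.sqrt v).
    rewrite RintegralD//.
    + by congr (_ + _); rewrite /Rintegral integral_normal_pdf.
    + apply: le_integrable ip => //.
        apply/measurable_EFinP; apply: measurable_funM => //.
        exact: measurable_normal_pdf.
      by move=> x _; rewrite /= lee_fin normrM ler_piMl//; exact: cos_max.
  - exact: measurable_funD.
  - by move=> x; have := cos_geN1 (u * x + b); lra.
rewrite RintegralD// Rintegral_cst// mul1r (_ : fine _ = 1) => [/addrI//|].
exact: (congr1 fine (probability_setT P)).
Qed.

End centered_gaussian.

(** * Square integrability and the isonormal process *)

Section square_integrable.
Context d (T : measurableType d) (R : realType) (mu : {measure set T -> \bar R}).
Variables (D : set T) (mD : measurable D).

Lemma integrable_mul_of_sqr (f g : T -> R) :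
  measurable_fun D f -> measurable_fun D g ->
  mu.-integrable D (EFin \o (fun x => f x ^+ 2)) ->
  mu.-integrable D (EFin \o (fun x => g x ^+ 2)) ->
  mu.-integrable D (EFin \o (fun x => f x * g x)).
Proof.
move=> mf mg fi gi; apply: le_integrable (integrableRD mD fi gi) => //.
  by apply/measurable_EFinP; exact: measurable_funM.
move=> x _; rewrite /= lee_fin [leRHS]ger0_norm ?addr_ge0 ?sqr_ge0//.
rewrite normrM -(real_normK (num_real (f x))) -(real_normK (num_real (g x))).
have := sqr_ge0 (`|f x| - `|g x|); have := sqr_ge0 (`|f x|).
by have := sqr_ge0 (`|g x|); lra.
Qed.

Lemma sqr_integrable_lty (f : T -> R) : measurable_fun D f ->
  (\int[mu]_(x in D) (f x ^+ 2)%:E < +oo)%E ->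
  mu.-integrable D (EFin \o (fun x => f x ^+ 2)).
Proof.
move=> mf fi; apply/integrableP; split.
  by apply/measurable_EFinP; exact: measurable_funX.
by under eq_integral do rewrite /= ger0_norm ?sqr_ge0//.
Qed.

Lemma Rintegral_sqr_lincomb (n : nat) (f : 'I_n -> T -> R) (c : 'I_n -> R) :
  (forall i j, mu.-integrable D (EFin \o (fun x => f i x * f j x))) ->
  \int[mu]_(x in D) ((\sum_i c i * f i x) ^+ 2) =
  \sum_i \sum_j c i * (c j * \int[mu]_(x in D) (f i x * f j x)).
Proof.
move=> ff; transitivity (\int[mu]_(x in D)
    (\sum_i \sum_j c i * (c j * (f i x * f j x)))).
  apply: eq_Rintegral => x _; rewrite expr2 mulr_suml.
  apply: eq_bigr => i _; rewrite mulr_sumr; apply: eq_bigr => j _; ring.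
have iZ i j : mu.-integrable D (EFin \o (fun x => c j * (f i x * f j x))).
  exact: integrableRZ.
rewrite Rintegral_sum// => [|i]; last first.
  by apply: integrableRsum => // j; exact: integrableRZ.
apply: eq_bigr => i _; rewrite Rintegral_sum// => [|j]; last exact: integrableRZ.
by apply: eq_bigr => j _; rewrite !RintegralZl.
Qed.

End square_integrable.

Section isonormal.
Context d (T : measurableType d) (R : realType) (P : probability T R).
Variables (W : (R -> R) -> {RV P >-> R}).
Hypothesis isoW : is_isonormal W.
Variables (n : nat) (f : 'I_n -> R -> R).
Hypothesis fL2 : forall i, in_L2_Rplus (f i).
Local Notation mu := (@lebesgue_measure R).
Local Notation D := (`[0%R, +oo[%classic : set R).

Let W_sqr i : P.-integrable setT (EFin \o (fun w => W (f i) w ^+ 2)).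
Proof.
have [v v0 h] := isoW.1 1%N (fun=> f i) (fun=> 1) (fun=> fL2 i).
apply: (@sqr_integrable _ _ _ _ _ v) => //.
rewrite (@centered_gaussian_sqr _ _ _ P _ v)// => A mA.
rewrite -(h A mA); congr (P _); apply/funext => w /=.
by rewrite big_ord_recl big_ord0 mul1r addr0.
Qed.

Lemma isonormal_sqr i :
  ('E_P[fun w => (W (f i) w ^+ 2)%R] =
   (\int[mu]_(s in D) (f i s ^+ 2))%:E)%E.
Proof.
transitivity ('E_P[fun w => (W (f i) w * W (f i) w)%R])%E.
  by congr expectation; apply/funext => w; rewrite expr2.
have [mf fi] := fL2 i.
rewrite isoW.2// /Rintegral fineK.
  by apply: eq_integral => s _; rewrite expr2.
by apply: integrable_fin_num => //; exact: sqr_integrable_lty.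
Qed.

(** The combination is Gaussian with an unspecified variance [v]. As [v] is its second moment,
    expanding the square and inserting the covariances turns [v] into the integral of
    [(sum_i c_i f_i)^2]. *)
Lemma isonormal_cos (c : 'I_n -> R) (b : R) :
  \int[P]_w cos (\sum_i c i * W (f i) w + b) =
  expR (- ((\int[mu]_(s in D) ((\sum_i c i * f i s) ^+ 2)) / 2)) * cos b.
Proof.
have [v v0 h] := isoW.1 n f c fL2.
have mY : measurable_fun setT (fun w => \sum_i c i * W (f i) w).
  by apply: measurable_sum => i; apply: measurable_funM.
have := centered_gaussian_cos mY v0 h 1 b; rewrite expr1n mul1r => hc.
under eq_Rintegral do rewrite -[\sum_i _]mul1r.
rewrite hc; congr (expR (- (_ / 2)) * _).
have := centered_gaussian_sqr mY v0 h.
rewrite unlock => /(congr1 fine)/= <-.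
rewrite -[LHS]/(\int[P]_w ((\sum_i c i * W (f i) w) ^+ 2)).
rewrite Rintegral_sqr_lincomb => [|//|i j]; last first.
  by apply: integrable_mul_of_sqr.
rewrite Rintegral_sqr_lincomb => [|//|i j]; last first.
  have [mi hi] := fL2 i; have [mj hj] := fL2 j.
  by apply: integrable_mul_of_sqr => //; exact: sqr_integrable_lty.
apply: eq_bigr => i _; apply: eq_bigr => j _; do 2 congr (_ * _).
by have := isoW.2 _ _ (fL2 i) (fL2 j); rewrite unlock /Rintegral => ->.
Qed.

End isonormal.

(** * Characteristic functions of compensated Poisson integrals *)

Section cos_exponential_series.
Variables (R : realType) (a : R).

Let c (b : R) (k : nat) : R := cos (k%:R * a + b) / k`!%:R.

Let is_cvg_c b x : cvgn (pseries (c b) x).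
Proof.
apply: normed_cvg; apply: (series_le_cvg _ _ _ (is_cvg_series_exp_coeff `|x|)).
- by move=> n; exact: normr_ge0.
- by move=> n; rewrite /exp_coeff/= divr_ge0// exprn_ge0.
- move=> n; rewrite /exp_coeff/= /c !normrM normrX normfV mulrAC.
  rewrite (ger0_norm (ler0n _ _)) ler_wpM2r ?invr_ge0//.
  by rewrite ler_piMl ?exprn_ge0//; exact: cos_max.
Qed.

Let diffs_c b : pseries_diffs (c b) = c (b + a).
Proof.
apply/funext => k; rewrite /pseries_diffs /c factS natrM -natr1.
rewrite (_ : (k%:R + 1) * a + b = k%:R * a + (b + a)); last by ring.
have k1 : k%:R + 1 != 0 :> R by rewrite natr1 pnatr_eq0.
have kf : k`!%:R != 0 :> R by rewrite pnatr_eq0 -lt0n fact_gt0.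
by field; rewrite kf.
Qed.

(* The real part of [e^(ib) exp (x e^(ia))]. *)
Let S b (x : R) := limn (pseries (c b) x).

Let is_derive_S b (x : R) : is_derive x 1 (S b) (S (b + a) x).
Proof.
rewrite /S -diffs_c; apply: (@pseries_snd_diffs _ _ (`|x| + 1)).
- exact: is_cvg_c.
- by rewrite diffs_c; exact: is_cvg_c.
- by rewrite !diffs_c; exact: is_cvg_c.
- by rewrite [ltRHS]ger0_norm ?addr_ge0// ltrDl.
Qed.

Let SE b x : S b x = cos b * S 0 x - sin b * S (- (pi / 2)) x.
Proof.
apply/cvg_lim => //.
rewrite (_ : pseries (c b) x = fun n => cos b * pseries (c 0) x n -
    sin b * pseries (c (- (pi / 2))) x n).
  by apply: cvgB; apply: cvgMr; exact: is_cvg_c.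
apply/funext => n; rewrite /pseries /series/= !mulr_sumr -sumrB.
by apply: eq_bigr => k _; rewrite /c addr0 cosBpihalf cosD; ring.
Qed.

Let S0 b : S b 0 = cos b.
Proof.
apply/cvg_lim => //; apply: cvg_near_cst; near=> n.
have -> : n = n.-1.+1 by rewrite prednK//; near: n; exact: nbhs_infty_gt.
rewrite /pseries /series/= big_nat_recl// expr0 mulr1 /c mul0r add0r fact0 divr1.
by rewrite big1 ?addr0// => k _; rewrite expr0n mulr0.
Unshelve. all: by end_near. Qed.

(** Differentiating the series in [x] shifts its phase by [a], so [S 0] and [S (- (pi / 2))], the
    real and imaginary parts of [exp (x e^(ia))], solve a linear system; the closed form follows by
    exhibiting a constant of motion. *)
Lemma cos_exp_series b (x : R) :
  series (fun k => x ^+ k / k`!%:R * cos (k%:R * a + b)) @ \oo -->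
  expR (x * cos a) * cos (x * sin a + b).
Proof.
(* The real part of [e^(id) exp (- y e^(ia)) (S 0 y + i S (- (pi / 2)) y)], hence constant in [y].
   The choice [d = x sin a + b] makes the phase at [y = x] equal to [b]. *)
pose H d (y : R) := expR (- (y * cos a)) *
  (cos (d - y * sin a) * S 0 y - sin (d - y * sin a) * S (- (pi / 2)) y).
have dH d (y : R) : is_derive y 1 (H d) 0.
  have := is_derive_S 0 y; rewrite add0r => hC.
  have := is_derive_S (- (pi / 2)) y => hD.
  rewrite /H; apply: is_derive_eq; rewrite /GRing.scale/=.
  rewrite (SE a) (SE (_ + a)) [- (pi / 2) + a]addrC cosBpihalf sinBpihalf.
  ring.
have HE : S b x = expR (x * cos a) * cos (x * sin a + b).
  have : H (x * sin a + b) x = cos (x * sin a + b).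
    transitivity (H (x * sin a + b) 0).
      exact: is_derive_0_is_cst.
    rewrite /H !mul0r oppr0 expR0 addr0 !S0 cos0 cosN cos_pihalf; ring.
  rewrite /H [_ + b]addrC addrK -SE => <-.
  by rewrite mulrA -expRD subrr expR0 mul1r.
rewrite -HE (_ : series _ = pseries (c b) x); first exact: is_cvg_c.
by apply/funext => n; apply: eq_bigr => k _; rewrite /c/= mulrC mulrA mulrAC.
Qed.

End cos_exponential_series.

Section cos_prod.
Import complex.
Variable R : realType.
Local Notation C := (complex R).

Let polar (r t : R) : C := Complex (r * cos t) (r * sin t).

Let prod_polar (I : Type) (s : seq I) (r t : I -> R) :
  \prod_(i <- s) polar (r i) (t i) =
  polar (\prod_(i <- s) r i) (\sum_(i <- s) t i).
Proof.
elim: s => [|i s IH]; first by rewrite !big_nil /polar cos0 sin0 mulr0 mulr1.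
rewrite !big_cons IH /polar cosD sinD.
by congr Complex => /=; ring.
Qed.

Let Re_sum (I : Type) (s : seq I) (F : I -> C) :
  complex.Re (\sum_(i <- s) F i) = \sum_(i <- s) complex.Re (F i).
Proof. by apply: (big_morph (@complex.Re R)) => // -[? ?] []. Qed.

Let Im_sum (I : Type) (s : seq I) (F : I -> C) :
  complex.Im (\sum_(i <- s) F i) = \sum_(i <- s) complex.Im (F i).
Proof. by apply: (big_morph (@complex.Im R)) => // -[? ?] []. Qed.

(** Complex numbers serve for algebra only; limits are taken on real and imaginary parts, which have
    to be carried together through the induction. *)
Let cvg_prod (I : Type) (s : seq I) (Z : I -> nat -> C) (L : I -> C) :
  (forall i, complex.Re (Z i n) @[n --> \oo] --> complex.Re (L i)) ->
  (forall i, complex.Im (Z i n) @[n --> \oo] --> complex.Im (L i)) ->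
  (complex.Re (\prod_(i <- s) Z i n) @[n --> \oo] -->
    complex.Re (\prod_(i <- s) L i)) /\
  (complex.Im (\prod_(i <- s) Z i n) @[n --> \oo] -->
    complex.Im (\prod_(i <- s) L i)).
Proof.
move=> cRe cIm; elim: s => [|i s [IH1 IH2]].
  rewrite !big_nil; split; under eq_fun do rewrite big_nil; exact: cvg_cst.
have ReM (x y : C) : complex.Re (x * y) =
    complex.Re x * complex.Re y - complex.Im x * complex.Im y.
  by case: x => ? ?; case: y.
have ImM (x y : C) : complex.Im (x * y) =
    complex.Re x * complex.Im y + complex.Im x * complex.Re y.
  by case: x => ? ?; case: y.
rewrite !big_cons; split.
  under eq_fun do rewrite big_cons ReM; rewrite ReM.
  by apply: cvgB; apply: cvgM.
under eq_fun do rewrite big_cons ImM; rewrite ImM.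
by apply: cvgD; apply: cvgM.
Qed.

(** The left side is [E cos (sum_i a_i k_i + b)] for independent Poisson [k_i], restricted to all
    [k_i < K]. It is the real part of [e^(ib)] times a product of truncated exponential series, the
    product of sums being distributed over finite functions. *)
Lemma sum_ffun_poisson_cos_cvg (n : nat) (lam a : 'I_n -> R) (b : R) :
  \sum_(k : {ffun 'I_n -> 'I_K})
    (\prod_i (expR (- lam i) * (lam i ^+ k i / (k i)`!%:R))) *
    cos (\sum_i a i * (k i)%:R + b) @[K --> \oo] -->
  expR (\sum_i lam i * (cos (a i) - 1)) * cos (\sum_i lam i * sin (a i) + b).
Proof.
pose p i (k : nat) : R := expR (- lam i) * (lam i ^+ k / k`!%:R).
pose Z i K : C := \sum_(k < K) polar (p i k) (a i * k%:R).
pose L i : C := polar (expR (lam i * (cos (a i) - 1))) (lam i * sin (a i)).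
have [cRe cIm] : (complex.Re (\prod_i Z i K) @[K --> \oo] -->
    complex.Re (\prod_i L i)) /\ (complex.Im (\prod_i Z i K) @[K --> \oo] -->
    complex.Im (\prod_i L i)).
  have h i c : \sum_(k < K) p i k * cos (a i * k%:R + c) @[K --> \oo] -->
      expR (lam i * (cos (a i) - 1)) * cos (lam i * sin (a i) + c).
    rewrite mulrBr mulr1 addrC expRD -mulrA.
    rewrite (_ : (fun K => _) = fun K => expR (- lam i) *
        series (fun k => lam i ^+ k / k`!%:R * cos (k%:R * a i + c)) K).
      by apply: cvgMr; exact: cos_exp_series.
    apply/funext => K; rewrite /series/= big_mkord mulr_sumr.
    by apply: eq_bigr => k _; rewrite /p -!mulrA [a i * _]mulrC.
  apply: cvg_prod => i; rewrite /Z /L.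
    under eq_fun do rewrite Re_sum/=.
    have := h i 0; rewrite addr0.
    by under eq_fun do under eq_bigr do rewrite addr0.
  under eq_fun do rewrite Im_sum/=.
  have := h i (- (pi / 2)); rewrite cosBpihalf.
  by under eq_fun do under eq_bigr do rewrite cosBpihalf.
rewrite cosD.
have -> : expR (\sum_i lam i * (cos (a i) - 1)) = \prod_i expR (lam i * (cos (a i) - 1)).
  by rewrite expR_sum.
move: cRe cIm; rewrite prod_polar /= => cRe cIm.
rewrite (_ : (fun K => _) = fun K => cos b * complex.Re (\prod_i Z i K) -
    sin b * complex.Im (\prod_i Z i K)).
  set x := \prod_i _; set t := \sum_i _.
  rewrite (_ : x * _ = cos b * (x * cos t) - sin b * (x * sin t)); last by ring.
  by apply: cvgB; apply: cvgMr; [exact: cRe|exact: cIm].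
apply/funext => K; rewrite bigA_distr_bigA/= Re_sum Im_sum !mulr_sumr -sumrB.
apply: eq_bigr => k _; rewrite prod_polar/= cosD /p; ring.
Qed.

End cos_prod.

(** At rate 0 the law is the Dirac mass at 0, and the formula persists because [0 ^+ 0 = 1]. *)
Lemma poisson_prob_set1 (R : realType) (lam : R) (k : nat) : 0 <= lam ->
  poisson_prob lam k [set k] = (expR (- lam) * (lam ^+ k / k`!%:R))%:E.
Proof.
move=> lam0; rewrite /poisson_prob; case: ifPn => [l0|].
  rewrite esum_set1 ?lee_fin ?poisson_pmf_ge0// /poisson_pmf l0.
  by congr EFin; ring.
rewrite -leNgt => l0; have -> : lam = 0 by apply/eqP; rewrite eq_le l0.
rewrite oppr0 expR0 mul1r diracE; congr EFin.
case: k => [|k]; first by rewrite expr0 fact0 divr1 mem_set.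
by rewrite expr0n mul0r memNset.
Qed.

Section independent_poisson.
Context d (T : measurableType d) (R : realType) (P : probability T R).
Variables (n : nat) (X : 'I_n -> T -> \bar R) (lam : 'I_n -> R).
Hypothesis mX : forall i, measurable_fun setT (X i).
Hypothesis lam0 : forall i, 0 <= lam i.
Hypothesis X_poisson : forall i (k : nat),
  P [set w | X i w = k%:R%:E] = poisson_prob (lam i) k [set k].
Hypothesis X_indep : mutually_independent P X.

(** The [X i] are extended real valued and only their masses at the integers are given. The events
    [B K k] (all [X i] equal to the integers [k i < K]) carry the truncated sums, and the mass they
    miss tends to 0. *)
Lemma independent_poisson_cos (a : 'I_n -> R) (b : R) :
  \int[P]_w cos (\sum_i a i * fine (X i w) + b) =
  expR (\sum_i lam i * (cos (a i) - 1)) * cos (\sum_i lam i * sin (a i) + b).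
Proof.
pose B K (k : {ffun 'I_n -> 'I_K}) : set T :=
  \bigcap_(i in [set: 'I_n]) (X i @^-1` [set (k i)%:R%:E]).
have mB K k : measurable (B K k).
  rewrite /B; apply: fin_bigcap_measurable => // i _.
  by rewrite -[X in measurable X]setTI; apply: (mX i).
pose p K (k : {ffun 'I_n -> 'I_K}) : R :=
  \prod_i (expR (- lam i) * (lam i ^+ k i / (k i)`!%:R)).
have PB K k : P (B K k) = (p K k)%:E.
  rewrite /B X_indep => [|i//]; rewrite /p -prodEFin.
  apply: eq_bigr => i _; rewrite -poisson_prob_set1// -X_poisson.
  by congr (P _).
pose c K (k : {ffun 'I_n -> 'I_K}) : R := cos (\sum_i a i * (k i)%:R + b).
have mY : measurable_fun setT (fun w => cos (\sum_i a i * fine (X i w) + b)).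
  apply: measurableT_comp.
    by apply: continuous_measurable_fun; exact: continuous_cos.
  apply: measurable_funD => //; apply: measurable_sum => i.
  by apply: measurable_funM => //; exact: measurableT_comp.
have i1 M (f : T -> R) : measurable_fun setT f -> (forall w, `|f w| <= M) ->
  P.-integrable setT (EFin \o f) by exact: bounded_integrable.
have iY : P.-integrable setT (EFin \o (fun w => cos (\sum_i a i * fine (X i w) + b))).
  by apply: (i1 1) => // w; exact: cos_max.
have iI K k : P.-integrable setT (EFin \o (\1_(B K k) : T -> R)).
  apply: (i1 1) => // w; rewrite indicE.
  by case: (w \in _); rewrite ?normr1 ?normr0.
have iS K F : P.-integrable setT (EFin \o (fun w => \sum_k F k * \1_(B K k) w)).
  by apply: integrableRsum => // k; exact: integrableRZ.
have intS K F : \int[P]_w (\sum_k F k * \1_(B K k) w) = \sum_k F k * p K k.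
  rewrite Rintegral_sum// => [|k]; last exact: integrableRZ.
  apply: eq_bigr => k _; rewrite RintegralZl//; congr (_ * _).
  by rewrite /Rintegral integral_indic// setIT; exact: (congr1 fine (PB K k)).
have sumB K (F : {ffun 'I_n -> 'I_K} -> R) w k : B K k w -> \sum_k F k * \1_(B K k) w = F k.
  move=> Bk; rewrite (bigD1 k)//= indicE mem_set// mulr1 big1 ?addr0// => k' kk'.
  rewrite indicE memNset ?mulr0// => Bk'; move/eqP: kk'; apply.
  apply/ffunP => i; apply/val_inj/eqP; rewrite /= -(eqr_nat R).
  by rewrite -eqe -(Bk' i I) -(Bk i I).
(* The two integrands agree on the disjoint events [B K k]; elsewhere the truncated one vanishes and
   the cosine is at most 1, so the error is bounded by the missing mass. *)
have key K : `|\int[P]_w cos (\sum_i a i * fine (X i w) + b) - \sum_k p K k * c K k|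
    <= 1 - \sum_k p K k.
  under eq_bigr do rewrite mulrC.
  rewrite -intS -RintegralB// (le_trans (le_normr_Rintegral _ _))//.
    exact: integrableRB.
  have -> : 1 - \sum_k p K k = \int[P]_w (1 - \sum_k 1 * \1_(B K k) w).
    rewrite RintegralB//.
      rewrite intS Rintegral_cst// mul1r; congr (_ - _).
        by rewrite (congr1 fine (probability_setT P)).
      by apply: eq_bigr => k _; rewrite mul1r.
    by apply: (i1 1) => // w; rewrite normr1.
  apply: le_Rintegral => //.
  - by apply: integrable_norm; exact: integrableRB.
  - by apply: integrableRB => //; apply: (i1 1) => // w; rewrite normr1.
  move=> w _; have [[k Bk]|nB] := pselect (exists k, B K k w).
    rewrite !(sumB _ _ _ _ Bk) /c subrr.
    rewrite (_ : \sum_i a i * fine (X i w) = \sum_i a i * (k i)%:R) ?subrr ?normr0//.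
    by apply: eq_bigr => i _; rewrite (Bk i I).
  have z (F : {ffun 'I_n -> 'I_K} -> R) : \sum_k F k * \1_(B K k) w = 0.
    rewrite big1// => k _; rewrite indicE memNset ?mulr0// => Bk.
    by apply: nB; exists k.
  by rewrite !z !subr0; exact: cos_max.
(* The total mass is the case [a = 0], [b = 0] of the limit of truncated sums. *)
have h0 : (fun K => \sum_k p K k) @ \oo --> (1 : R).
  have := @sum_ffun_poisson_cos_cvg R n lam (fun=> 0) 0.
  rewrite [X in _ --> X -> _](_ : _ = 1); last first.
    by rewrite cos0 sin0 subrr -mulr_suml mulr0 addr0 expR0 cos0 mulr1.
  move=> h; rewrite [X in X @ _](_ : _ = fun K => \sum_(k : {ffun 'I_n -> 'I_K})
    p K k * cos (\sum_i 0 * (k i)%:R + 0)); first exact: h.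
  apply/funext => K; apply: eq_bigr => k _.
  by rewrite big1 ?addr0 ?cos0 ?mulr1// => i _; rewrite mul0r.
have h1 : 1 - \sum_k p K k @[K --> \oo] --> (0 : R).
  have := cvgB (cvg_cst (1 : R)) h0; rewrite subrr; exact.
have h2 := @sum_ffun_poisson_cos_cvg R n lam a b.
apply: (cvg_unique _ _ h2) => //.
apply/cvgrPdist_le => e e0; have /cvgrPdist_le/(_ _ e0) := h1.
apply: filterS => K; rewrite sub0r normrN => h.
by rewrite (le_trans (key K))// (le_trans (ler_norm _)).
Qed.

End independent_poisson.

(** * Taylor bounds for sine and cosine *)

Section taylor.
Variable R : realType.
Implicit Types x y : R.

(** The engine of the Taylor bounds below: each integrates an earlier one, starting from [sin <= 1]
    and [cos <= 1]. *)
Lemma nonneg_of_derive (G g : R -> R) x :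
  (forall y : R, is_derive y 1 G (g y)) -> (forall y, 0 <= y -> 0 <= g y) ->
  G 0 = 0 -> 0 <= x -> 0 <= G x.
Proof.
move=> dG g0 G0 x0.
have cG : continuous G.
  by move=> y; apply/differentiable_continuous/derivable1_diffP; have [] := dG y.
have [y /[!in_itv]/= /andP[y0 _]] := @MVT_segment _ G g 0 x x0 (fun y _ => dG y)
  (continuous_subspaceT cG).
by rewrite G0 !subr0 => ->; rewrite mulr_ge0// g0.
Qed.

Let sin_le x : 0 <= x -> sin x <= x.
Proof.
move=> x0; rewrite -subr_ge0.
apply: (@nonneg_of_derive (fun y => y - sin y) (fun y => 1 - cos y)).
- by move=> y _; rewrite subr_ge0 cos_le1.
- by rewrite sin0 subrr.
- exact: x0.
Qed.

Let cos_ge x : 0 <= x -> 1 - x <= cos x.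
Proof.
move=> x0; rewrite -subr_ge0.
apply: (@nonneg_of_derive (fun y => cos y - (1 - y)) (fun y => - sin y + 1)).
- by move=> y; apply: is_derive_eq; rewrite ?scaler1 ?scale1r; ring.
- by move=> y _; have := sin_le1 y; lra.
- by rewrite cos0; ring.
- exact: x0.
Qed.

Let cos_ge2 x : 0 <= x -> 1 - x ^+ 2 / 2 <= cos x.
Proof.
move=> x0; rewrite -subr_ge0.
apply: (@nonneg_of_derive (fun y => cos y - (1 - y ^+ 2 / 2))
  (fun y => y - sin y)).
- move=> y; apply: is_derive_eq; rewrite /GRing.scale/=; by field.
- by move=> y /sin_le; rewrite subr_ge0.
- by rewrite cos0; ring.
- exact: x0.
Qed.

Let sin_ge2 x : 0 <= x -> x - x ^+ 2 / 2 <= sin x.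
Proof.
move=> x0; rewrite -subr_ge0.
apply: (@nonneg_of_derive (fun y => sin y - (y - y ^+ 2 / 2))
  (fun y => cos y - (1 - y))).
- move=> y; apply: is_derive_eq; rewrite /GRing.scale/=; by field.
- by move=> y /cos_ge; rewrite subr_ge0.
- by rewrite sin0; ring.
- exact: x0.
Qed.

Let sin_ge3 x : 0 <= x -> x - x ^+ 3 / 6 <= sin x.
Proof.
move=> x0; rewrite -subr_ge0.
apply: (@nonneg_of_derive (fun y => sin y - (y - y ^+ 3 / 6))
  (fun y => cos y - (1 - y ^+ 2 / 2))).
- move=> y; apply: is_derive_eq; rewrite /GRing.scale/=; by field.
- by move=> y /cos_ge2; rewrite subr_ge0.
- by rewrite sin0; ring.
- exact: x0.
Qed.

Let cos_le3 x : 0 <= x -> cos x <= 1 - x ^+ 2 / 2 + x ^+ 3 / 6.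
Proof.
move=> x0; rewrite -subr_ge0.
apply: (@nonneg_of_derive (fun y => 1 - y ^+ 2 / 2 + y ^+ 3 / 6 - cos y)
  (fun y => sin y - (y - y ^+ 2 / 2))).
- move=> y; apply: is_derive_eq; rewrite /GRing.scale/=; by field.
- by move=> y /sin_ge2; rewrite subr_ge0.
- by rewrite cos0; ring.
- exact: x0.
Qed.

(* Modulus of [e^(ix) - 1 - ix + x^2/2], up to a constant. *)
Definition cis_remainder x := `|cos x - 1 + x ^+ 2 / 2| + `|sin x - x|.

Lemma cis_remainder0 : cis_remainder 0 = 0.
Proof. by rewrite /cis_remainder cos0 sin0 expr0n/= mul0r !subrr add0r normr0 addr0. Qed.

Let cis_remainder_norm x : cis_remainder `|x| = cis_remainder x.
Proof.
have [x0|x0] := leP 0 x; first by rewrite ger0_norm.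
rewrite ltr0_norm// /cis_remainder cosN sinN sqrrN; congr (_ + _).
by rewrite opprK -normrN opprD opprK.
Qed.

Let cis_remainderE x : 0 <= x ->
  cis_remainder x = (cos x - 1 + x ^+ 2 / 2) + (x - sin x).
Proof.
move=> x0; rewrite /cis_remainder; congr (_ + _).
  by rewrite ger0_norm//; have := cos_ge2 x0; lra.
by rewrite distrC ger0_norm// subr_ge0 sin_le.
Qed.

Lemma cis_remainder_le2 x : cis_remainder x <= x ^+ 2.
Proof.
rewrite -cis_remainder_norm -(real_normK (num_real x)) cis_remainderE//.
by have := sin_ge2 (normr_ge0 x); have := cos_le1 `|x|; lra.
Qed.

Lemma cis_remainder_le3 x : cis_remainder x <= `|x| ^+ 3.
Proof.
rewrite -cis_remainder_norm cis_remainderE//.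
have := sin_ge3 (normr_ge0 x); have := cos_le3 (normr_ge0 x).
by have : 0 <= `|x| ^+ 3 by []; lra.
Qed.

(** If [|x| <= 2 |y|], the cubic bound gives [8 |y|^3]; otherwise [|x - y| >= |x| / 2] and the
    quadratic bound gives [4 (x - y)^2]. With [x] the value of an approximation and [y] that of its
    limit, L^2 convergence kills the second term and only the limit is cubed. *)
Lemma cis_remainder_le x y :
  cis_remainder x <= 8 * `|y| ^+ 3 + 4 * (x - y) ^+ 2.
Proof.
have y3 : 0 <= `|y| ^+ 3 by [].
have xy2 : 0 <= (x - y) ^+ 2 := sqr_ge0 _.
have [xy|xy] := leP `|x| (2 * `|y|).
  rewrite (le_trans (cis_remainder_le3 x))//.
  apply: (@le_trans _ _ ((2 * `|y|) ^+ 3)); first by rewrite lerXn2r ?nnegrE// mulr_ge0.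
  by rewrite exprMn; lra.
rewrite (le_trans (cis_remainder_le2 x))//.
have : `|x| ^+ 2 <= (2 * `|x - y|) ^+ 2.
  rewrite lerXn2r ?nnegrE ?mulr_ge0//.
  by have := lerB_dist x y; lra.
by rewrite exprMn !real_normK ?num_real//; lra.
Qed.

Lemma norm_expR_sub_le x y : x <= 0 -> y <= 0 -> `|expR x - expR y| <= `|x - y|.
Proof.
wlog xy : x y / x <= y => [hw|] x0 y0.
  have [|/ltW] := leP x y; first by move=> /hw; exact.
  by move=> /hw h; rewrite distrC [leRHS]distrC; exact: h.
rewrite distrC ger0_norm ?subr_ge0 ?ler_expR// distrC ger0_norm ?subr_ge0//.
have h := expR_ge1Dx (x - y).
have e1 : expR y <= 1 by rewrite expR_le1.
have -> : expR x = expR y * expR (x - y) by rewrite -expRD; congr expR; ring.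
have : expR y * (1 - expR (x - y)) <= 1 * (1 - expR (x - y)).
  by rewrite ler_wpM2r// subr_ge0 expR_le1 subr_le0.
by lra.
Qed.

Lemma norm_cos_sub_le x y : `|cos x - cos y| <= `|x - y|.
Proof.
wlog xy : x y / x <= y => [hw|].
  have [|/ltW] := leP x y; first exact: hw.
  by move=> /hw h; rewrite distrC [leRHS]distrC.
have [z _] := @MVT_segment _ cos (fun y => - sin y) x y xy
  (fun y _ => is_derive_cos y) (continuous_subspaceT (@continuous_cos R)).
rewrite distrC => ->; rewrite normrM normrN (distrC x).
by rewrite ler_piMl//; exact: sin_max.
Qed.

End taylor.

(** * Simple functions and their compensated integrals *)

Section sfun_decomposition.
Import HBSimple.
Context d (E : measurableType d) (R : realType).

(** A single partition serves every [F] vanishing at 0, since the identity, the square and the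
    remainder of [g] are all to be integrated, against [m] and against each [N w]. The value 0 is
    left out so that all pieces lie in the support of [g], which has finite measure in the
    applications. *)
Lemma sfun_decomposition (g : {sfun E >-> R}) :
  exists n (v : 'I_n -> R) (A : 'I_n -> set E),
  [/\ forall i, measurable (A i), trivIset setT A,
      forall i, A i `<=` [set z | g z != 0] &
      forall F : R -> R, F 0 = 0 ->
        forall z, F (g z) = \sum_i F (v i) * \1_(A i) z].
Proof.
have /finite_seqP[s0 gs0] : finite_set (range g) by exact: fimfunP.
pose s := undup [seq a <- s0 | a != 0].
have us : uniq s by exact: undup_uniq.
have gs z : g z != 0 -> g z \in s.
  move=> gz0; rewrite mem_undup mem_filter gz0/=.
  by have : [set` s0] (g z) by rewrite -gs0; exists z.
exists (size s), (fun i => s`_i), (fun i => g @^-1` [set s`_i]); split.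
- move=> i; rewrite -[X in measurable X]setTI.
  by apply: (measurable_funP g) => //; exact: measurable_set1.
- apply/trivIsetP => i j _ _ ij; apply/seteqP; split => // z /= [-> /eqP].
  by rewrite nth_uniq// => /eqP/val_inj/eqP; rewrite (negbTE ij).
- move=> i z /= ->; have : s`_i \in s by exact: mem_nth.
  by rewrite mem_undup mem_filter => /andP[].
move=> F F0 z; have [gz0|gz0] := eqVneq (g z) 0.
  rewrite gz0 F0 big1// => i _; rewrite indicE memNset ?mulr0//= => gzi.
  have : s`_i \in s by exact: mem_nth.
  by rewrite mem_undup mem_filter -gzi gz0 eqxx.
have gzs := gs _ gz0.
have iz : (index (g z) s < size s)%N by rewrite index_mem.
rewrite (bigD1 (Ordinal iz))//= indicE mem_set/= ?nth_index// mulr1.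
rewrite big1 ?addr0// => i; rewrite indicE => ine.
rewrite memNset ?mulr0//= => gzi; move/eqP: ine; apply.
by apply/val_inj => /=; rewrite gzi index_uniq.
Qed.

Lemma integrable_lincomb_indic (mu : {measure set E -> \bar R}) n
    (c : 'I_n -> R) (A : 'I_n -> set E) :
  (forall i, measurable (A i)) -> (forall i, mu (A i) < +oo)%E ->
  mu.-integrable setT (EFin \o (fun z => \sum_i c i * \1_(A i) z)) /\
  \int[mu]_z (\sum_i c i * \1_(A i) z) = \sum_i c i * fine (mu (A i)).
Proof.
move=> mA Afin.
have iA i : mu.-integrable setT (EFin \o (\1_(A i) : E -> R)).
  apply/integrableP; split; first exact/measurable_EFinP/measurable_indic.
  under eq_integral do rewrite /= ger0_norm//.
  by rewrite integral_indic// setIT.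
split; first by apply: integrableRsum => // i; exact: integrableRZ.
rewrite Rintegral_sum// => [|i]; last exact: integrableRZ.
apply: eq_bigr => i _; rewrite RintegralZl//; congr (_ * _).
by rewrite /Rintegral integral_indic// setIT.
Qed.

End sfun_decomposition.

Section simple_integrable.
Import HBSimple.
Context d (E : measurableType d) (R : realType).

Lemma measurable_sfun_neq0 (g : {sfun E >-> R}) : measurable [set z | g z != 0].
Proof.
rewrite (_ : [set z | _] = ~` (g @^-1` [set 0])); last first.
  by apply/seteqP; split => z /= /eqP.
apply: measurableC; rewrite -[X in measurable X]setTI.
by apply: (measurable_funP g) => //; exact: measurable_set1.
Qed.

Lemma sfun_integral (mu : {measure set E -> \bar R}) (g : {sfun E >-> R})
    n (v : 'I_n -> R) (A : 'I_n -> set E) (F : R -> R) :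
  (mu [set z | g z != 0%R] < +oo)%E ->
  (forall i, measurable (A i)) -> (forall i, A i `<=` [set z | g z != 0]) ->
  (forall z, F (g z) = \sum_i F (v i) * \1_(A i) z) ->
  mu.-integrable setT (EFin \o (F \o g)) /\
  \int[mu]_z (F (g z)) = \sum_i F (v i) * fine (mu (A i)).
Proof.
move=> gfin mA Ag gE.
have Afin i : (mu (A i) < +oo)%E.
  apply: le_lt_trans gfin; apply: le_measure; rewrite ?inE; [exact: mA|exact: measurable_sfun_neq0|exact: Ag].
have [h1 h2] := integrable_lincomb_indic (fun i => F (v i)) mA Afin.
rewrite -h2; split; last by apply: eq_Rintegral => z _; rewrite gE.
by apply: eq_integrable h1 => // z _; rewrite /= gE.
Qed.

Lemma sfun_integrable (mu : {measure set E -> \bar R}) (g : {sfun E >-> R})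
    (F : R -> R) : F 0 = 0 -> (mu [set z | g z != 0%R] < +oo)%E ->
  mu.-integrable setT (EFin \o (F \o g)).
Proof.
move=> F0 gfin; have [n [v [A [mA _ Ag gE]]]] := sfun_decomposition g.
by have [] := sfun_integral gfin mA Ag (gE F F0).
Qed.

End simple_integrable.

Section compensated_sint.
Import HBSimple.
Context d dE (Om : measurableType d) (E : measurableType dE) (R : realType).
Variables (P : probability Om R) (N : R.-ker Om ~> E)
  (m : {measure set E -> \bar R}).
Hypothesis N_poisson : is_poisson_random_measure P N m.

(** The Poisson probabilities of the events [N A = k] sum to 1, so these events exhaust the space up
    to a null set. *)
Lemma poisson_random_measure_fin A : measurable A -> (m A < +oo)%E ->
  {ae P, forall w, (N w A < +oo)%E}.
Proof.
move=> mA Afin; have [hP _ _] := N_poisson.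
pose B k : set Om := [set w | N w A = k%:R%:E].
have mN : measurable_fun setT (fun w => N w A) by exact: measurable_kernel.
have mB k : measurable (B k).
  by rewrite -[X in measurable X]setTI; exact: (mN measurableT _ (emeasurable_set1 k%:R%:E)).
have mU : measurable (\bigcup_k B k) by exact: bigcupT_measurable.
have tB : trivIset setT B.
  apply/trivIsetP => i j _ _ ij; apply/seteqP; split => // w [].
  rewrite /B /= => -> [] /eqP; rewrite eqr_nat => /eqP ije.
  by move: ij; rewrite ije eqxx.
have PU : P (\bigcup_k B k) = 1%E.
  rewrite measure_bigcup//.
  transitivity (poisson_prob (fine (m A)) 0%N (\bigcup_k [set k])); last first.
    rewrite (_ : \bigcup_k _ = setT) ?probability_setT//.
    by apply/seteqP; split => // k _; exists k.
  rewrite measure_bigcup//; last first.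
    by apply/trivIsetP => i j _ _ ij; apply/seteqP; split => // w [/= ->] /eqP; rewrite (negbTE ij).
  by apply: eq_eseriesr => k _; exact: hP.
exists (~` \bigcup_k B k); split.
- exact: measurableC.
- have := probability_setC P mU; rewrite PU => ->; exact: subee.
- move=> w /= hw [k _ Bk]; apply: hw; rewrite Bk; exact: ltry.
Qed.

Lemma measurable_compensated_sint g :
  measurable_fun setT (compensated_sint N m g).
Proof.
rewrite /compensated_sint; apply: measurable_funB => //.
apply: measurableT_comp => //.
under eq_fun do rewrite integralE.
have mg : measurable_fun setT (EFin \o g) by exact/measurable_EFinP.
apply: emeasurable_funB; apply: measurable_fun_integral_kernel => //.
- by move=> U mU; exact: measurable_kernel.
- exact: measurable_funepos.
- by move=> U mU; exact: measurable_kernel.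
- exact: measurable_funeneg.
Qed.

Lemma ae_fin_sfun (g : {sfun E >-> R}) : (m [set z | g z != 0%R] < +oo)%E ->
  {ae P, forall w, (N w [set z | g z != 0%R] < +oo)%E}.
Proof.
by move=> gfin; apply: poisson_random_measure_fin => //; exact: measurable_sfun_neq0.
Qed.

Lemma compensated_sintE (g : {sfun E >-> R}) w :
  compensated_sint N m g w = \int[N w]_z g z - \int[m]_z g z.
Proof. by []. Qed.

(** Linearity holds for those outcomes [w] at which [N w] is finite on both supports, where the
    simple functions are integrable; hence almost everywhere. *)
Lemma ae_compensated_sint_linear (a : R) (g g' h : {sfun E >-> R}) :
  (m [set z | g z != 0%R] < +oo)%E -> (m [set z | g' z != 0%R] < +oo)%E ->
  (forall z, h z = a * g z + g' z) ->
  {ae P, forall w, compensated_sint N m h w =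
    a * compensated_sint N m g w + compensated_sint N m g' w}.
Proof.
move=> gfin g'fin hE.
have lin (mu : {measure set E -> \bar R}) :
    (mu [set z | g z != 0%R] < +oo)%E -> (mu [set z | g' z != 0%R] < +oo)%E ->
    \int[mu]_z h z = a * \int[mu]_z g z + \int[mu]_z g' z.
  move=> gm g'm; have ig := sfun_integrable (erefl : idfun 0 = 0 :> R) gm.
  have ig' := sfun_integrable (erefl : idfun 0 = 0 :> R) g'm.
  under eq_Rintegral do rewrite hE.
  by rewrite RintegralD// ?RintegralZl//; exact: integrableRZ.
apply: filterS2 (ae_fin_sfun gfin) (ae_fin_sfun g'fin) => w gw g'w.
by rewrite !compensated_sintE !lin//; ring.
Qed.

End compensated_sint.

Section compensated_integral.
Import HBSimple.
Context d dE (Om : measurableType d) (E : measurableType dE) (R : realType).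
Variables (P : probability Om R) (N : R.-ker Om ~> E)
  (m : {measure set E -> \bar R}).
Hypothesis N_poisson : is_poisson_random_measure P N m.

Lemma cos_integrable (X : Om -> R) (b : R) : measurable_fun setT X ->
  P.-integrable setT (EFin \o (fun w => cos (X w + b))).
Proof.
move=> mX; apply: (@bounded_integrable _ _ _ _ _ 1).
  apply: measurableT_comp.
    by apply: continuous_measurable_fun; exact: continuous_cos.
  exact: measurable_funD.
by move=> w; exact: cos_max.
Qed.

(** With [g = sum_i v_i 1_(A_i)] and [l_i = m (A_i)], the Poisson formula gives [exp a cos (b + B)],
    where [a = sum_i l_i (cos v_i - 1)] and [B = sum_i l_i (sin v_i - v_i)]; the compensator [c]
    contributes the terms [- v_i]. The remainder integral dominates [|a + V / 2| + |B|], with [V]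
    the integral of [g^2]. *)
Lemma compensated_sint_cos (g : {sfun E >-> R}) (b : R) :
  (m [set z | g z != 0%R] < +oo)%E ->
  `|\int[P]_w cos (compensated_sint N m g w + b) -
    expR (- ((\int[m]_z (g z ^+ 2)) / 2)) * cos b| <=
  \int[m]_z cis_remainder (g z).
Proof.
move=> gfin; have [n [v [A [mA tA Ag gE]]]] := sfun_decomposition g.
have hsum (mu : {measure set E -> \bar R}) (F : R -> R) :
    (mu [set z | g z != 0%R] < +oo)%E -> F 0 = 0 ->
    \int[mu]_z (F (g z)) = \sum_i F (v i) * fine (mu (A i)).
  by move=> gmu F0; have [_ ->] := sfun_integral gmu mA Ag (gE F F0).
pose l i := fine (m (A i)).
have l0 i : 0 <= l i by rewrite fine_ge0.
have Afin i : (m (A i) < +oo)%E.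
  apply: le_lt_trans gfin; apply: le_measure; rewrite ?inE;
    [exact: mA|exact: measurable_sfun_neq0|exact: Ag].
pose c := \sum_i v i * l i.
have -> : \int[P]_w cos (compensated_sint N m g w + b) =
    \int[P]_w cos (\sum_i v i * fine (N w (A i)) + (b - c)).
  congr fine; apply: ae_eq_integral => //.
  - apply/measurable_int; exact: (cos_integrable _ (measurable_compensated_sint N m g)).
  - apply/measurable_int; apply: cos_integrable; apply: measurable_sum => i.
    apply: measurable_funM => //; apply: measurableT_comp => //.
    exact: measurable_kernel.
  - apply: filterS (ae_fin_sfun N_poisson gfin) => w gw _; congr (_%:E); congr cos.
    rewrite compensated_sintE (hsum _ id gw)// (hsum _ id gfin)//.
    by rewrite /c /l; ring.
have [hP _ hI] := N_poisson.
rewrite (@independent_poisson_cos _ _ _ P n (fun i w => N w (A i)) l) => //; last first.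
- exact: hI.
- by move=> i k; exact: hP.
- by move=> i; exact: measurable_kernel.
rewrite (hsum _ (fun x => x ^+ 2))// ?expr0n//.
rewrite (hsum _ (@cis_remainder R))// ?cis_remainder0//.
set a := \sum_i l i * (cos (v i) - 1).
rewrite -/l; set V := \sum_i v i ^+ 2 * _.
rewrite addrCA; set B := \sum_i _ - c.
have a0 : a <= 0.
  by rewrite /a; apply: sumr_le0 => i _; rewrite mulr_ge0_le0// subr_le0 cos_le1.
have V0 : 0 <= V by apply: sumr_ge0 => i _; rewrite mulr_ge0 ?sqr_ge0// l0.
have aV : `|a + V / 2| + `|B| <= \sum_i cis_remainder (v i) * l i.
  apply: (@le_trans _ _ (\sum_i (`|cos (v i) - 1 + v i ^+ 2 / 2| * l i) +
      \sum_i (`|sin (v i) - v i| * l i))); last first.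
    by rewrite -big_split/=; apply: ler_sum => i _; rewrite -mulrDl.
  apply: lerD.
    rewrite /a /V mulr_suml -big_split/= (le_trans (ler_norm_sum _ _ _))//.
    apply: ler_sum => i _; rewrite -[X in _ <= _ * X](ger0_norm (l0 i)) -normrM.
    by rewrite le_eqVlt; apply/orP; left; apply/eqP; congr `|_|; rewrite /l; ring.
  rewrite /B /c -sumrB (le_trans (ler_norm_sum _ _ _))//.
  apply: ler_sum => i _; rewrite -[X in _ <= _ * X](ger0_norm (l0 i)) -normrM.
  by rewrite le_eqVlt; apply/orP; left; apply/eqP; congr `|_|; ring.
apply: le_trans aV.
(* Modulus and phase are changed one at a time; [exp] on nonpositive reals and [cos] are
   1-Lipschitz, and the other factor is at most 1. *)
rewrite (_ : _ - _ = (expR a - expR (- (V / 2))) * cos (b + B) +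
   expR (- (V / 2)) * (cos (b + B) - cos b)); last by ring.
rewrite (le_trans (ler_normD _ _))// !normrM lerD//.
  apply: (@le_trans _ _ (`|expR a - expR (- (V / 2))| * 1)).
    by rewrite ler_wpM2l// cos_max.
  rewrite mulr1 (le_trans (norm_expR_sub_le _ _))// ?opprK//.
  by rewrite oppr_le0 divr_ge0.
apply: (@le_trans _ _ (1 * `|cos (b + B) - cos b|)).
  by rewrite ler_wpM2r// ger0_norm ?expR_ge0// expR_le1 oppr_le0 divr_ge0.
by rewrite mul1r (le_trans (norm_cos_sub_le _ _))// addrAC subrr add0r.
Qed.

Lemma sfun_lincomb (a : R) (g g' : {sfun E >-> R}) :
  {h : {sfun E >-> R} | forall z, h z = a * g z + g' z}.
Proof. by exists (cst_sfun a * g + g'). Qed.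

Lemma sqrD_le (x y : R) : (x + y) ^+ 2 <= 2 * x ^+ 2 + 2 * y ^+ 2.
Proof. by have := sqr_ge0 (x - y); lra. Qed.

Lemma cvge0_integral_sqrD dT (T : measurableType dT)
    (mu : {measure set T -> \bar R}) (u v : nat -> T -> R) (a : R)
    (w : nat -> T -> R) :
  (forall n, measurable_fun setT (u n)) -> (forall n, measurable_fun setT (v n)) ->
  (forall n, measurable_fun setT (w n)) ->
  (\int[mu]_x (u n x ^+ 2)%:E @[n --> \oo] --> 0)%E ->
  (\int[mu]_x (v n x ^+ 2)%:E @[n --> \oo] --> 0)%E ->
  (forall n, {ae mu, forall x, w n x = a * u n x + v n x}) ->
  (\int[mu]_x (w n x ^+ 2)%:E @[n --> \oo] --> 0)%E.
Proof.
move=> mu' mv mw u0 v0 wE.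
have sq (f : T -> R) : measurable_fun setT f ->
    measurable_fun setT (fun x => (f x ^+ 2)%:E).
  by move=> mf; apply/measurable_EFinP; exact: measurable_funX.
apply: (@squeeze_cvge _ _ _ _ (cst 0%E) _ (fun n =>
  ((2 * a ^+ 2)%:E * \int[mu]_x (u n x ^+ 2)%:E +
   2%:E * \int[mu]_x (v n x ^+ 2)%:E)%E)).
- apply: nearW => n; apply/andP; split.
    by apply: integral_ge0 => x _; rewrite lee_fin sqr_ge0.
  rewrite -ge0_integralZl//; [|exact: sq|by move=> x _; rewrite lee_fin sqr_ge0|
    by rewrite lee_fin mulr_ge0 ?sqr_ge0].
  rewrite -ge0_integralZl//; [|exact: sq|by move=> x _; rewrite lee_fin sqr_ge0].
  rewrite -ge0_integralD//; last 4 first.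
  - by move=> x _; rewrite -EFinM lee_fin mulr_ge0 ?sqr_ge0// mulr_ge0 ?sqr_ge0.
  - by apply: emeasurable_funM => //; exact: sq.
  - by move=> x _; rewrite -EFinM lee_fin mulr_ge0 ?sqr_ge0.
  - by apply: emeasurable_funM => //; exact: sq.
  apply: ae_ge0_le_integral => //.
  - by move=> x _; rewrite lee_fin sqr_ge0.
  - exact: sq.
  - by move=> x _; rewrite -!EFinM -EFinD lee_fin addr_ge0// mulr_ge0 ?sqr_ge0// mulr_ge0 ?sqr_ge0.
  - by apply: emeasurable_funD; apply: emeasurable_funM => //; exact: sq.
  - apply: filterS (wE n) => x -> _; rewrite -!EFinM -EFinD lee_fin.
    by rewrite (le_trans (sqrD_le _ _))// exprMn mulrA.
- exact: cvg_cst.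
- rewrite -(adde0 0%E); apply: cvgeD => //.
    by rewrite -(mule0 (2 * a ^+ 2)%:E); apply: cvgeZl.
  by rewrite -(mule0 2%:E); apply: cvgeZl.
Qed.

(* [is_compensated_integral] for a function [X] which need not be bundled
   as a random variable. *)
Definition compensated_L2_limit (f : E -> R) (X : Om -> R) : Prop :=
  exists g : nat -> {sfun E >-> R},
    [/\ forall n, (m [set z | g n z != 0%R] < +oo)%E,
        (\int[m]_z ((g n z - f z) ^+ 2)%:E @[n --> \oo] --> 0)%E &
        (\int[P]_w ((compensated_sint N m (g n) w - X w) ^+ 2)%:E
          @[n --> \oo] --> 0)%E].

Lemma compensated_L2_limit0 : compensated_L2_limit (fun=> 0) (fun=> 0).
Proof.
exists (fun=> cst_sfun 0); split => [n| |].
- by rewrite (_ : [set z | _] = set0) ?measure0 ?ltry//; apply/seteqP; split => // z /=; rewrite eqxx.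
- apply: cvg_near_cst; apply: nearW => n.
  by rewrite integral0_eq// => z _; rewrite subrr expr0n.
- apply: cvg_near_cst; apply: nearW => n.
  rewrite integral0_eq// => w _; rewrite compensated_sintE.
  by rewrite !Rintegral_cst// !mul0r !subr0 expr0n.
Qed.

Lemma compensated_L2_limit_linear (a : R) f f' X X' :
  measurable_fun setT f -> measurable_fun setT f' ->
  measurable_fun setT X -> measurable_fun setT X' ->
  compensated_L2_limit f X -> compensated_L2_limit f' X' ->
  compensated_L2_limit (fun z => a * f z + f' z) (fun w => a * X w + X' w).
Proof.
move=> mf mf' mX mX' [g [gfin gf gX]] [g' [g'fin g'f g'X]].
pose h n := sval (sfun_lincomb a (g n) (g' n)).
have hE n z : h n z = a * g n z + g' n z := svalP (sfun_lincomb a (g n) (g' n)) z.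
move: h hE => h hE.
have lin (x y x' y' : R) : a * x + y - (a * x' + y') = a * (x - x') + (y - y').
  by ring.
exists h; split.
- move=> n; have : (m ([set z | g n z != 0%R] `|` [set z | g' n z != 0%R]) < +oo)%E.
    apply: le_lt_trans (lte_add_pinfty (gfin n) (g'fin n)).
    by apply: measureU2; exact: measurable_sfun_neq0.
  apply: le_lt_trans; apply: le_measure; rewrite ?inE.
  + exact: measurable_sfun_neq0.
  + by apply: measurableU; exact: measurable_sfun_neq0.
  + move=> z /=; rewrite hE; apply: contraPP => /not_orP[/negP/negPn/eqP -> /negP/negPn/eqP ->].
    by rewrite mulr0 addr0 eqxx.
- apply: (cvge0_integral_sqrD _ _ _ gf g'f).
  + by move=> n; exact: measurable_funB.
  + by move=> n; exact: measurable_funB.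
  + move=> n; apply: measurable_funB => //.
    by apply: measurable_funD => //; exact: measurable_funM.
  + move=> n; apply: aeW => z; rewrite hE.
    exact: lin.
- apply: (cvge0_integral_sqrD _ _ _ gX g'X).
  + by move=> n; apply: measurable_funB => //; exact: measurable_compensated_sint.
  + by move=> n; apply: measurable_funB => //; exact: measurable_compensated_sint.
  + move=> n; apply: measurable_funB; first exact: measurable_compensated_sint.
    by apply: measurable_funD => //; exact: measurable_funM.
  + move=> n; apply: filterS
      (ae_compensated_sint_linear N_poisson (gfin n) (g'fin n) (hE n)) => w ->.
    exact: lin.
Qed.

(** The Cramer-Wold reduction: joint laws of several integrals are read off single integrals of
    combined integrands. *)
Lemma compensated_L2_limit_sum (n : nat) (a : 'I_n -> R)
    (f : 'I_n -> E -> R) (X : 'I_n -> Om -> R) :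
  (forall i, measurable_fun setT (f i)) -> (forall i, measurable_fun setT (X i)) ->
  (forall i, compensated_L2_limit (f i) (X i)) ->
  compensated_L2_limit (fun z => \sum_i a i * f i z) (fun w => \sum_i a i * X i w).
Proof.
move=> mf mX h; elim: (index_enum 'I_n) => [|i s IH].
  rewrite (_ : (fun z => _) = fun=> 0); last by apply/funext => z; rewrite big_nil.
  rewrite (_ : (fun w => _) = fun=> 0); last by apply/funext => w; rewrite big_nil.
  exact: compensated_L2_limit0.
rewrite (_ : (fun z => _) = fun z => a i * f i z + \sum_(j <- s) a j * f j z); last first.
  by apply/funext => z; rewrite big_cons.
rewrite (_ : (fun w => _) = fun w => a i * X i w + \sum_(j <- s) a j * X j w); last first.
  by apply/funext => w; rewrite big_cons.
apply: compensated_L2_limit_linear => //.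
  by apply: measurable_sum => j; exact: measurable_funM.
by apply: measurable_sum => j; exact: measurable_funM.
Qed.

End compensated_integral.

(** * Passage from simple to square-integrable integrands *)

Section compensated_limit.
Import HBSimple.
Context d dE (Om : measurableType d) (E : measurableType dE) (R : realType).
Variables (P : probability Om R) (N : R.-ker Om ~> E)
  (m : {measure set E -> \bar R}).
Hypothesis N_poisson : is_poisson_random_measure P N m.

(** From [|cos x - cos y| <= t <= e + t^2 / e] with [t = |x - y|]; the free parameter [e] plays the
    role of the Cauchy-Schwarz inequality. *)
Lemma le_Rintegral_cos_sub (X Y : Om -> R) (b e : R) :
  measurable_fun setT X -> measurable_fun setT Y -> 0 < e ->
  P.-integrable setT (EFin \o (fun w => (Y w - X w) ^+ 2)) ->
  `|\int[P]_w cos (X w + b) - \int[P]_w cos (Y w + b)| <=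
    e + e^-1 * \int[P]_w ((Y w - X w) ^+ 2).
Proof.
move=> mX mY e0 iXY.
have iX := cos_integrable P b mX; have iY := cos_integrable P b mY.
have i1 : P.-integrable setT (EFin \o (fun=> e)).
  by apply: (@bounded_integrable _ _ _ _ _ e) => // x; rewrite ger0_norm// ltW.
rewrite -RintegralB// (le_trans (le_normr_Rintegral _ _))//.
  exact: integrableRB.
have -> : e + e^-1 * \int[P]_w ((Y w - X w) ^+ 2) =
    \int[P]_w (e + e^-1 * (Y w - X w) ^+ 2).
  rewrite RintegralD//; last exact: integrableRZ.
  rewrite RintegralZl// Rintegral_cst// (_ : fine _ = 1) ?mulr1//.
  exact: (congr1 fine (probability_setT P)).
apply: le_Rintegral => //.
- by apply: integrable_norm; exact: integrableRB.
- by apply: integrableRD => //; exact: integrableRZ.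
move=> w _; rewrite (le_trans (norm_cos_sub_le _ _))// opprD addrACA subrr addr0.
rewrite distrC -(real_normK (num_real (Y w - X w))).
set t := `|_|; have t0 : 0 <= t by exact: normr_ge0.
have h : 0 <= e^-1 * (t - e) ^+ 2 by rewrite mulr_ge0 ?sqr_ge0// invr_ge0 ltW.
have h' : e^-1 * (t - e) ^+ 2 = e^-1 * t ^+ 2 - 2 * t + e.
  by field; rewrite gt_eqF.
have h'' : 0 <= e^-1 * t ^+ 2 by rewrite mulr_ge0 ?sqr_ge0// invr_ge0 ltW.
by lra.
Qed.

(** With [t = g - f], the difference of squares is [t^2 + 2 t f], and
    [2 |t f| <= e f^2 + t^2 / e]. *)
Lemma le_Rintegral_sqr_sub (f g : E -> R) (e : R) :
  measurable_fun setT f -> measurable_fun setT g -> 0 < e ->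
  m.-integrable setT (EFin \o (fun z => f z ^+ 2)) ->
  m.-integrable setT (EFin \o (fun z => (g z - f z) ^+ 2)) ->
  m.-integrable setT (EFin \o (fun z => g z ^+ 2)) ->
  `|\int[m]_z (g z ^+ 2) - \int[m]_z (f z ^+ 2)| <=
    e * \int[m]_z (f z ^+ 2) + (1 + e^-1) * \int[m]_z ((g z - f z) ^+ 2).
Proof.
move=> mf mg e0 iff igf ig.
rewrite -RintegralB// (le_trans (le_normr_Rintegral _ _))//.
  exact: integrableRB.
rewrite -RintegralZl// -RintegralZl// -RintegralD//; try exact: integrableRZ.
apply: le_Rintegral => //.
- by apply: integrable_norm; exact: integrableRB.
- by apply: integrableRD => //; exact: integrableRZ.
move=> z _; set t := g z - f z; have -> : g z = f z + t by rewrite /t addrC subrK.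
rewrite (_ : _ - _ = t ^+ 2 + 2 * (t * f z)); last by ring.
rewrite [leRHS](_ : _ = t ^+ 2 + (e * f z ^+ 2 + e^-1 * t ^+ 2)); last by ring.
rewrite (le_trans (ler_normD _ _))// (ger0_norm (sqr_ge0 t)) lerD2l.
rewrite normrM (ger0_norm (ler0n _ 2)) normrM.
rewrite -[in leRHS](real_normK (num_real t)) -(real_normK (num_real (f z))).
move: `|t| `|f z| => x y.
have h : 0 <= e^-1 * (x - e * y) ^+ 2 by rewrite mulr_ge0 ?sqr_ge0// invr_ge0 ltW.
have h' : e^-1 * (x - e * y) ^+ 2 = e^-1 * x ^+ 2 - 2 * (x * y) + e * y ^+ 2.
  by field; rewrite gt_eqF.
by lra.
Qed.

(** The estimate for one well chosen [g n] is transferred to [f], up to an arbitrary [e], by three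
    comparisons: [X] with its approximation, the two variances, and the remainder of [g n] with
    [|f|^3]. The constant 8 is that of [cis_remainder_le]. *)
Lemma compensated_L2_limit_cos (f : E -> R) (X : Om -> R) (b : R) :
  measurable_fun setT f -> measurable_fun setT X ->
  m.-integrable setT (EFin \o (fun z => f z ^+ 2)) ->
  m.-integrable setT (EFin \o (fun z => `|f z| ^+ 3)) ->
  compensated_L2_limit P N m f X ->
  `|\int[P]_w cos (X w + b) - expR (- ((\int[m]_z (f z ^+ 2)) / 2)) * cos b|
  <= 8 * \int[m]_z (`|f z| ^+ 3).
Proof.
move=> mf mX if2 if3 [g [gfin gf gX]].
set r := 8 * _; set V := \int[m]_z (f z ^+ 2).
have V0 : 0 <= V by apply: Rintegral_ge0 => z _; exact: sqr_ge0.
pose Xn n := compensated_sint N m (g n).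
have mXn n : measurable_fun setT (Xn n) by exact: measurable_compensated_sint.
pose Dn n := \int[m]_z ((g n z - f z) ^+ 2).
pose En n := \int[P]_w ((Xn n w - X w) ^+ 2).
have [gf_fin gf0] := (fine_cvgP _ _).1 gf.
have [gX_fin gX0] := (fine_cvgP _ _).1 gX.
have sq dT (T : measurableType dT) (mu : {measure set T -> \bar R}) (u : T -> R) :
    measurable_fun setT u -> (\int[mu]_x (u x ^+ 2)%:E \is a fin_num)%E ->
    mu.-integrable setT (EFin \o (fun x => u x ^+ 2)).
  move=> mu' fin; apply: sqr_integrable_lty => //.
  by rewrite -ge0_fin_numE//; apply: integral_ge0 => x _; rewrite lee_fin sqr_ge0.
apply/ler_addgt0Pr => e e0.
(* [a] is the parameter of both quadratic inequalities above; their fixed costs [a] and [a V] fit in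
   [e / 2]. The other half of [e] pays for the terms in [En] and [Dn], where the coefficient 5 is 4
   from the remainder plus 1 from the variances. *)
pose a := e / (2 * (2 + V)).
have a0 : 0 < a by rewrite divr_gt0// mulr_gt0// ltr_wpDr.
have aV : a * (2 + V) = e / 2 by rewrite /a; field; rewrite gt_eqF// ltr_wpDr.
have lim0 : a^-1 * En n + (5 + a^-1) * Dn n @[n --> \oo] --> (0 : R).
  have gX0' : En n @[n --> \oo] --> (0 : R) by exact: gX0.
  have gf0' : Dn n @[n --> \oo] --> (0 : R) by exact: gf0.
  rewrite [X in _ --> X](_ : _ = a^-1 * 0 + (5 + a^-1) * 0); last by ring.
  by apply: cvgD; apply: cvgMr.
have e20 : 0 < e / 2 by rewrite divr_gt0.
have /cvgrPdist_le/(_ _ e20) near0 := lim0.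
(* Convergence to 0 in the extended reals makes the integrals finite only eventually, so finiteness
   takes part in the choice of [n]. *)
have [n [[hn gn] Xn_fin]] := @filter_ex _ \oo _ _
  (filterI (filterI near0 gf_fin) gX_fin).
have iD := sq _ _ m _ (measurable_funB (@measurable_funP _ _ _ _ setT (g n)) mf) gn.
have iE := sq _ _ P _ (measurable_funB (mXn n) mX) Xn_fin.
have ig2 : m.-integrable setT (EFin \o (fun z => g n z ^+ 2)).
  exact: (sfun_integrable (F := fun x => x ^+ 2) (expr0n _ 2) (gfin n)).
have mg : measurable_fun setT (g n) by exact: measurable_funP.
have h1 := le_Rintegral_cos_sub b mX (mXn n) a0 iE.
have h2 := compensated_sint_cos N_poisson b (gfin n).
have h3 := le_Rintegral_sqr_sub mf mg a0 if2 iD ig2.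
have h4 : \int[m]_z cis_remainder (g n z) <= r + 4 * Dn n.
  rewrite /r /Dn -!RintegralZl// -RintegralD//; try exact: integrableRZ.
  apply: le_Rintegral => //.
  - exact: (sfun_integrable (@cis_remainder0 R) (gfin n)).
  - by apply: integrableRD => //; exact: integrableRZ.
  - by move=> z _; exact: cis_remainder_le.
have h5 : `|expR (- ((\int[m]_z (g n z ^+ 2)) / 2)) * cos b - expR (- (V / 2)) * cos b| <=
    `|\int[m]_z (g n z ^+ 2) - V|.
  have Vn0 : 0 <= \int[m]_z (g n z ^+ 2).
    by apply: Rintegral_ge0 => z _; exact: sqr_ge0.
  rewrite -mulrBl normrM.
  apply: (@le_trans _ _ (`|expR (- ((\int[m]_z (g n z ^+ 2)) / 2)) - expR (- (V / 2))| * 1)).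
    by rewrite ler_wpM2l// cos_max.
  rewrite mulr1 (le_trans (norm_expR_sub_le _ _)) ?oppr_le0 ?divr_ge0//.
  rewrite -opprD normrN -mulNr -mulrDl normrM [X in _ * X]ger0_norm// ler_pdivrMr//.
  by rewrite ler_peMr// ler1n.
have h6 : a^-1 * En n + (5 + a^-1) * Dn n <= e / 2.
  by rewrite (le_trans (ler_norm _))// -normrN -[X in `|X|]add0r.
apply: le_trans (ler_distD (\int[P]_w cos (Xn n w + b)) _ _) _.
apply: le_trans (lerD h1 (ler_distD (expR (- ((\int[m]_z (g n z ^+ 2)) / 2)) * cos b) _ _)) _.
apply: le_trans (lerD (lexx _) (lerD h2 h5)) _.
apply: le_trans (lerD (lexx _) (lerD h4 h3)) _.
rewrite -/V -/(Dn n) -/(En n).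
have aV' : a * (2 + V) = 2 * a + a * V by ring.
move: aV' aV h6; rewrite !mulrDl mul1r.
move: (a^-1 * En n) (a^-1 * Dn n) (Dn n) (a * V) => x y u v.
by lra.
Qed.

End compensated_limit.

(** * Second moments from characteristic functions *)

Section second_moment.
Import HBSimple.
Context d (T : measurableType d) (R : realType) (P : probability T R).

(* Fatou's lemma along [2 (1 - cos (u X)) / u^2 --> X^2]. *)
Lemma expectation_sqr_le_of_cos (X : T -> R) (v r : R) :
  measurable_fun setT X ->
  (forall u, 0 < u ->
    1 - \int[P]_w cos (u * X w) <= u ^+ 2 * v / 2 + u ^+ 3 * r) ->
  ('E_P[fun w => (X w ^+ 2)%R] <= v%:E)%E.
Proof.
move=> mX hcos.
pose u (n : nat) : R := n.+1%:R^-1.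
have u0 n : 0 < u n by rewrite invr_gt0.
have u20 n : 0 < 2 * (u n) ^- 2 by rewrite mulr_gt0// invr_gt0 exprn_gt0.
pose f n w : R := 2 * (u n) ^- 2 * (1 - cos (u n * X w)).
have f0 n w : 0 <= f n w.
  by rewrite /f mulr_ge0 ?(ltW (u20 n))// subr_ge0 cos_le1.
have mc n : measurable_fun setT (fun w => cos (u n * X w)).
  apply: measurableT_comp.
    by apply: continuous_measurable_fun; exact: continuous_cos.
  exact: measurable_funM.
have ic n : P.-integrable setT (EFin \o (fun w => cos (u n * X w))).
  by apply: (@bounded_integrable _ _ _ _ _ 1) => // w; exact: cos_max.
have i1 : P.-integrable setT (EFin \o (fun=> 1 : R)).
  by apply: (@bounded_integrable _ _ _ _ _ 1) => // w; rewrite normr1.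
have icc n : P.-integrable setT (EFin \o (fun w => 1 - cos (u n * X w))).
  exact: integrableRB.
have intf n : (\int[P]_w (f n w)%:E <= (v + 2 * r * u n)%:E)%E.
  have -> : (\int[P]_w (f n w)%:E = (2 * (u n) ^- 2 * (1 - \int[P]_w cos (u n * X w)))%:E)%E.
    rewrite -[LHS]fineK; last first.
      by apply: integrable_fin_num => //; exact: integrableRZ.
    rewrite -[fine _]/(\int[P]_w f n w) RintegralZl// RintegralB// Rintegral_cst//.
    by rewrite (_ : fine _ = 1) ?mulr1//; exact: (congr1 fine (probability_setT P)).
  rewrite lee_fin; apply: le_trans (ler_wpM2l (ltW (u20 n)) (hcos _ (u0 n))) _.
  by rewrite le_eqVlt; apply/orP; left; apply/eqP; field; rewrite gt_eqF.
(* The cubic Taylor bound at [y = u n * X w] gives the error [2 |X w|^3 u n]. *)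
have limf w : (f n w)%:E @[n --> \oo] --> (X w ^+ 2)%:E.
  apply: cvg_EFin; first exact: nearW.
  apply/cvgrPdist_le => e e0 /=.
  have : 2 * `|X w| ^+ 3 * u n @[n --> \oo] --> (2 * `|X w| ^+ 3 * 0 : R).
    by apply: cvgMr; exact: cvg_harmonic.
  rewrite mulr0 => /cvgrPdist_le/(_ _ e0); apply: filterS => n.
  rewrite sub0r normrN => h; apply: le_trans h.
  apply: le_trans (ler_norm _).
  set y := u n * X w.
  have -> : X w ^+ 2 - f n w = 2 * (u n) ^- 2 * (cos y - 1 + y ^+ 2 / 2).
    by rewrite /f -/y /y; field; rewrite gt_eqF.
  rewrite normrM (gtr0_norm (u20 n)).
  have h : `|cos y - 1 + y ^+ 2 / 2| <= `|y| ^+ 3.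
    apply: le_trans (cis_remainder_le3 y).
    by rewrite /cis_remainder lerDl.
  apply: le_trans (ler_wpM2l (ltW (u20 n)) h) _.
  rewrite /y normrM (gtr0_norm (u0 n)).
  by rewrite le_eqVlt; apply/orP; left; apply/eqP; field; rewrite gt_eqF.
rewrite unlock.
have mf n : measurable_fun setT (fun w => (f n w)%:E).
  apply/measurable_EFinP; apply: measurable_funM => //.
  exact: measurable_funB.
have f0' n w : setT w -> (0 <= (f n w)%:E)%E by rewrite lee_fin.
have := fatou P measurableT mf f0'.
under eq_integral => w _ do rewrite (cvg_limn_einf_sup (limf w)).1.
move/le_trans; apply.
have vlim : (v + 2 * r * u n)%:E @[n --> \oo] --> v%:E.
  apply: cvg_EFin; first exact: nearW.
  rewrite [X in _ --> X](_ : v = v + 2 * r * 0); last by ring.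
  apply: cvgD; first exact: cvg_cst.
  by apply: cvgMr; exact: cvg_harmonic.
rewrite limn_einf_lim -(cvg_lim _ vlim)//; apply: lee_lim.
- exact: is_cvg_einfs.
- by apply/cvg_ex; exists v%:E.
- apply: nearW => n; apply: le_trans (intf n).
  by apply: ereal_inf_lbound; exists n => /=.
Qed.

End second_moment.

Section compensated_limit_sqr.
Import HBSimple.
Context d dE (Om : measurableType d) (E : measurableType dE) (R : realType).
Variables (P : probability Om R) (N : R.-ker Om ~> E)
  (m : {measure set E -> \bar R}).
Hypothesis N_poisson : is_poisson_random_measure P N m.

(** The characteristic function estimate for [u f] has error [8 u^3 int |f|^3 dm]; with
    [1 - exp (- y) <= y] it provides the expansion near [u = 0] that controls the second moment. *)
Lemma compensated_L2_limit_sqr (f : E -> R) (X : Om -> R) :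
  measurable_fun setT f -> measurable_fun setT X ->
  m.-integrable setT (EFin \o (fun z => f z ^+ 2)) ->
  m.-integrable setT (EFin \o (fun z => `|f z| ^+ 3)) ->
  compensated_L2_limit P N m f X ->
  ('E_P[fun w => (X w ^+ 2)%R] <= (\int[m]_z (f z ^+ 2))%:E)%E.
Proof.
move=> mf mX if2 if3 fX.
apply: (@expectation_sqr_le_of_cos _ _ _ _ _ _ (8 * \int[m]_z (`|f z| ^+ 3))) => //.
move=> u u0.
have ufX : compensated_L2_limit P N m (fun z => u * f z) (fun w => u * X w).
  rewrite (_ : (fun z => u * f z) = fun z => u * f z + 0); last first.
    by apply/funext => z; rewrite addr0.
  rewrite (_ : (fun w => u * X w) = fun w => u * X w + 0); last first.
    by apply/funext => w; rewrite addr0.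
  apply: (compensated_L2_limit_linear N_poisson) => //.
  exact: compensated_L2_limit0.
have sq z : (u * f z) ^+ 2 = u ^+ 2 * f z ^+ 2 by rewrite exprMn.
have cu z : `|u * f z| ^+ 3 = u ^+ 3 * `|f z| ^+ 3.
  by rewrite normrM exprMn gtr0_norm.
have := @compensated_L2_limit_cos _ _ _ _ _ _ _ _ N_poisson
  (fun z => u * f z) (fun w => u * X w) 0.
rewrite (_ : (fun z => (u * f z) ^+ 2) = fun z => u ^+ 2 * f z ^+ 2); last first.
  by apply/funext.
rewrite (_ : (fun z => `|u * f z| ^+ 3) = fun z => u ^+ 3 * `|f z| ^+ 3); last first.
  by apply/funext.
move=> /(_ (measurable_funM (measurable_cst u) mf) (measurable_funM (measurable_cst u) mX)
  (integrableRZ measurableT _ if2) (integrableRZ measurableT _ if3) ufX).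
rewrite !RintegralZl// cos0 mulr1.
under eq_Rintegral do rewrite addr0.
set c := \int[P]_w _; set v := \int[m]_z (f z ^+ 2); set r := \int[m]_z _.
move=> h; have h1 := expR_ge1Dx (- (u ^+ 2 * v / 2)).
have := le_trans (ler_norm _) (le_trans (_ : `|expR (- (u ^+ 2 * v / 2)) - c| <= _) h).
rewrite distrC lexx => /(_ isT) h2.
rewrite (mulrCA (u ^+ 3)).
by lra.
Qed.

End compensated_limit_sqr.

(** * Integrals of the small jumps *)

Section mrestr_integral.
Context d (T : measurableType d) (R : realType) (mu : {measure set T -> \bar R}).

Lemma ge0_integral_mrestr (D : set T) (mD : measurable D) (f : T -> \bar R) :
  measurable_fun setT f -> (forall x, 0 <= f x)%E ->
  (\int[mrestr mu mD]_x f x = \int[mu]_(x in D) f x)%E.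
Proof.
move=> mf f0.
have mDC : measurable (~` D) by exact: measurableC.
have dD : [disjoint D & ~` D] by apply/disj_setPS; rewrite setICr.
have mf' : measurable_fun (D `|` ~` D) f by rewrite setUv.
rewrite -(setUv D) ge0_integral_setU//=.
rewrite [X in (_ + X)%E](_ : _ = 0%E) ?adde0.
  apply: eq_measure_integral => A mA AD.
  by rewrite /= /mrestr setIidl.
apply: null_set_integral => //; first exact: measurable_funTS.
by rewrite /= /mrestr setICl measure0.
Qed.

End mrestr_integral.

(** Product measures and Tonelli's theorem take sigma-finiteness from the structure, whereas for
    [nu] it is a proved property. *)
Definition to_sigma_finite d (T : measurableType d) (R : realType)
    (mu : {measure set T -> \bar R}) (h : sigma_finite setT mu) :
    {sigma_finite_measure set T -> \bar R} :=
  HB.pack (mu : set T -> \bar R)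
    (isMeasure.Build _ _ _ (mu : set T -> \bar R) (measure0 mu) (measure_ge0 mu)
      (@measure_semi_sigma_additive _ _ _ mu))
    (isSFinite.Build _ _ _ (mu : set T -> \bar R)
      (sfinite_measure_sigma_finite h))
    (isSigmaFinite.Build _ _ _ (mu : set T -> \bar R) h).

Section levy_intensity_measure.
Variables (R : realType) (nu : {measure set R -> \bar R}).
Hypothesis nu_sigma_finite : sigma_finite setT nu.

Let nu' := to_sigma_finite nu_sigma_finite.

Let m1 := mrestr (@lebesgue_measure R) (measurable_itv `[0%R, +oo[).

Let measurable_iota :
  measurable_fun setT (idfun : measurableTypeR R -> R).
Proof. exact: measurable_id. Qed.

(* [R] and [measurableTypeR R] carry distinct measurable structures with
   the same measurable sets; [m1'] is [m1] on the first one. *)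
Let m1_semi_sigma_additive : @semi_sigma_additive _ R R (m1 : set R -> \bar R).
Proof. exact: (@measure_semi_sigma_additive _ _ _ m1). Qed.

Let m1' : {measure set R -> \bar R} := HB.pack (m1 : set R -> \bar R)
  (isMeasure.Build _ R R (m1 : set R -> \bar R)
    (measure0 m1) (measure_ge0 m1) m1_semi_sigma_additive).

Let m1'_sigma_finite : sigma_finite setT m1'.
Proof.
have [F FT Ffin] := @sigma_finiteT _ _ R (@lebesgue_measure R).
exists F => // n; have [mF Fn] := Ffin n; split => //.
rewrite /m1' /m1 /= /mrestr; apply: le_lt_trans Fn.
apply: le_measure; rewrite ?inE.
- exact: (measurableI _ _ mF (measurable_itv `[0%R, +oo[)).
- exact: mF.
- exact: subIsetl.
Qed.

Let m1'' := to_sigma_finite m1'_sigma_finite.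

(** Both sides integrate the [nu]-measure of the sections of [A], over the two measurable structures
    on the line; pushing forward along the identity matches them. *)
Let levyE (A : set (R * R)) : measurable A ->
  levy_intensity nu A = (m1'' \x nu')%E A.
Proof.
move=> mA; rewrite /levy_intensity /product_measure1.
have mx := measurable_fun_xsection nu' mA.
rewrite -[RHS]/(\int[pushforward m1 (idfun : measurableTypeR R -> R)]_x (nu' \o xsection A) x)%E.
by rewrite ge0_integral_pushforward.
Qed.

Let levy0 : levy_intensity nu set0 = 0%E.
Proof. by rewrite levyE ?measure0. Qed.

Let levy_ge0 A : (0 <= levy_intensity nu A)%E.
Proof. by apply: integral_ge0 => x _; exact: measure_ge0. Qed.

Let levy_semi_sigma_additive :
  @semi_sigma_additive _ R (R * R)%type (levy_intensity nu).
Proof.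
move=> F mF tF mUF; rewrite levyE//.
under eq_fun do under eq_bigr do rewrite levyE//.
exact: measure_semi_sigma_additive.
Qed.

(** The underlying set function is [levy_intensity nu] itself, so that hypotheses on the intensity
    apply to this measure as they stand. *)
Definition levy_measure : {measure set (R * R) -> \bar R} :=
  HB.pack (levy_intensity nu : set (R * R) -> \bar R)
    (isMeasure.Build _ (R * R)%type R (levy_intensity nu)
      levy0 levy_ge0 levy_semi_sigma_additive).

Lemma ge0_integral_levy_measure (f : R * R -> \bar R) :
  measurable_fun setT f -> (forall z, 0 <= f z)%E ->
  (\int[levy_measure]_z f z =
   \int[lebesgue_measure]_(s in `[0%R, +oo[) \int[nu]_x f (s, x))%E.
Proof.
move=> mf f0.
transitivity (\int[m1'' \x nu']_z f z)%E.
  by apply: eq_measure_integral => A mA _; exact: levyE.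
rewrite fubini_tonelli1//.
have mF := measurable_fun_fubini_tonelli_F (m2 := nu') f mf f0.
have F0 x : (0 <= fubini_F nu' f x)%E by apply: integral_ge0.
rewrite -[LHS]/(\int[pushforward m1 (idfun : measurableTypeR R -> R)]_x
  fubini_F nu' f x)%E.
rewrite ge0_integral_pushforward//.
by rewrite ge0_integral_mrestr.
Qed.

End levy_intensity_measure.

(** The exhausting sets are [{0}], which is null, joined to [|x| >= 1 / (n + 1)], whose measure is
    finite by Chebyshev's inequality for [x^2]. *)
Lemma sqr_integrable_sigma_finite (R : realType) (nu : {measure set R -> \bar R}) :
  nu [set 0%R] = 0%E -> (\int[nu]_x (x ^+ 2)%:E < +oo)%E -> sigma_finite setT nu.
Proof.
move=> nu0 nu2.
pose G (n : nat) : set R := [set x | n.+1%:R^-1 <= `|x|].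
pose F n : set R := [set 0] `|` G n.
have mG n : measurable (G n).
  rewrite (_ : G n = (@Num.norm R R) @^-1` `[n.+1%:R^-1, +oo[); last first.
    by apply/seteqP; split => x /=; rewrite in_itv/= andbT.
  by rewrite -[X in measurable X]setTI; exact: normr_measurable.
exists F.
  apply/seteqP; split => // x _.
  have [->|x0] := eqVneq x 0; first by exists 0%N => //; left.
  have x0' : 0 < `|x| by rewrite normr_gt0.
  exists (Num.truncn (`|x|^-1)) => //; right => /=.
  rewrite /G/= invf_ple ?posrE//; apply: ltW; exact: truncnS_gt.
move=> n; split; first by apply: measurableU => //; exact: measurable_set1.
apply: (@le_lt_trans _ _ (nu [set 0%R] + nu (G n))%E).
  by apply: measureU2 => //; exact: measurable_set1.
rewrite nu0 add0e.
have c0 : 0 < n.+1%:R^-1 ^+ 2 :> R by rewrite exprn_gt0// invr_gt0.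
have : ((n.+1%:R^-1 ^+ 2)%:E * nu (G n) < +oo)%E.
  apply: le_lt_trans nu2; rewrite -integral_cst//.
  apply: (@le_trans _ _ (\int[nu]_(x in G n) (x ^+ 2)%:E)%E).
    apply: ge0_le_integral => //.
    - by move=> x _; rewrite lee_fin ltW.
    - by apply/measurable_EFinP; apply: measurable_funTS; exact: measurable_funX.
    - move=> x /= nx; rewrite lee_fin -[leRHS]real_normK ?num_real//.
      by rewrite lerXn2r ?nnegrE.
  apply: ge0_subset_integral => //.
  - by apply/measurable_EFinP; exact: measurable_funX.
  - by move=> x _; rewrite lee_fin sqr_ge0.
by case: (nu (G n)) => [r| |]; rewrite ?ltry ?ltNyr// gt0_muley// lte_fin.
Qed.

(** * Integrability of the truncated integrands *)

Section truncated_function.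
Variables (R : realType) (T t : R) (h : R -> R).
Hypothesis tT : 0 <= t <= T.
Hypothesis mh : measurable_fun (`]0, T[ : set R) h.
Hypothesis h3 : (\int[lebesgue_measure]_(s in `]0%R, T[) (`|h s| ^+ 3)%:E < +oo)%E.
Local Notation mu := (@lebesgue_measure R).
Local Notation hb := (fun s : R => h s * \1_(`[0, t]) s).

(** Measurability of [h] is given on the open interval, while [[0, t]] may contain 0 and [T]; on
    these singletons every function is measurable. *)
Lemma measurable_truncated : measurable_fun (setT : set R) hb.
Proof.
rewrite (_ : hb = h \_ `[0, t]); last first.
  apply/funext => s; rewrite patchE indicE; case: ifPn => _; first by rewrite mulr1.
  by rewrite mulr0.
apply/(measurable_restrictT _ _).1; first exact: measurable_itv.
have m0 : measurable_fun ((`]0, T[ : set R) `|` [set 0] `|` [set T]) h.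
  apply/measurable_funU; [exact: measurableU|exact: measurable_set1|split].
    apply/measurable_funU; [exact: measurable_itv|exact: measurable_set1|split => //].
    exact: measurable_fun_set1.
  exact: measurable_fun_set1.
apply: measurable_funS m0.
  by apply: measurableU; [apply: measurableU|].
move=> s /=; rewrite !in_itv/= => /andP[s0 st].
have [->|sn0] := eqVneq s 0; first by left; right.
have [->|snT] := eqVneq s T; first by right.
left; left; rewrite lt_neqAle eq_sym sn0 s0/= lt_neqAle snT/=.
by case/andP: tT => _; exact: le_trans.
Qed.

(** The endpoints 0 and [T] are Lebesgue null, and beyond [T] the truncated function vanishes. *)
Lemma truncated_L3 :
  (\int[mu]_(s in `[0%R, +oo[) (`|hb s| ^+ 3)%:E < +oo)%E.
Proof.
have mhb3 D : measurable_fun D (fun s => (`|hb s| ^+ 3)%:E).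
  apply: measurable_funTS; apply/measurable_EFinP; apply: measurable_funX.
  by apply: measurableT_comp => //; exact: measurable_truncated.
rewrite -integral_itv_obnd_cbnd//.
rewrite (_ : (\int[mu]_(s in `]0%R, +oo[) _)%E =
    (\int[mu]_(s in `]0%R, T]) (`|hb s| ^+ 3)%:E)%E); last first.
  rewrite [LHS]integral_mkcond [RHS]integral_mkcond; apply: eq_integral => s _.
  rewrite !patchE !mem_setE !in_itv/= andbT.
  have [s0|s0]//= := ltP 0 s; have [sT|Ts]//= := leP s T.
  rewrite indicE memNset ?mulr0 ?normr0 ?expr0n//= in_itv/= => /andP[_ st].
  by case/andP: tT => _ /(le_trans st); rewrite leNgt Ts.
rewrite -integral_itv_bndo_bndc//.
apply: le_lt_trans h3; apply: ge0_le_integral => //.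
- exact: mhb3.
- by apply/measurable_EFinP; apply: measurable_funX; exact: measurableT_comp.
- move=> s _; rewrite lee_fin lerXn2r ?nnegrE// normrM ler_piMr//.
  by rewrite indicE; case: (_ \in _); rewrite ?normr1 ?normr0.
Qed.

(** On [[0, T]], which has finite length, [x^2 <= 1 + x^3] for [x = |h s|]. *)
Lemma truncated_L2 : in_L2_Rplus hb.
Proof.
have mhb := measurable_truncated; have hb3 := truncated_L3.
split; first exact: measurable_funTS.
have mD : measurable (`[0%R, +oo[%classic : set R) by exact: measurable_itv.
apply: (@le_lt_trans _ _ (\int[mu]_(s in `[0%R, +oo[)
  ((\1_(`[0, T]) s)%:E + (`|hb s| ^+ 3)%:E)))%E.
  apply: ge0_le_integral => //.
  - by move=> s _; rewrite lee_fin sqr_ge0.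
  - by apply/measurable_EFinP/measurable_funTS; exact: measurable_funX.
  - apply: emeasurable_funD; first exact/measurable_EFinP/measurable_indic.
    apply: measurable_funTS; apply/measurable_EFinP; apply: measurable_funX.
    exact: measurableT_comp.
  - move=> s _; rewrite -EFinD lee_fin; have [s01|s01] := boolP (s \in (`[0, t]%classic : set R)); last first.
      by rewrite [X in h s * X]indicE (negbTE s01) mulr0 expr0n normr0 expr0n addr_ge0.
    rewrite [X in X + _]indicE mem_set/=; last first.
      move: s01; rewrite inE/= !in_itv/= => /andP[-> st].
      by case/andP: tT => _ /(le_trans st).
    rewrite -(real_normK (num_real (hb s))); set x := `|_|.
    have x0 : 0 <= x by exact: normr_ge0.
    have : 0 <= x * (x - 1) ^+ 2 by rewrite mulr_ge0 ?sqr_ge0.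
    have : 0 <= (x - 1) ^+ 2 by rewrite sqr_ge0.
    have x3 : 0 <= x ^+ 3 by rewrite exprn_ge0.
    have [x1|x1] := leP x 1.
      have : x ^+ 2 <= 1 by rewrite expr_le1.
      by rewrite /=; lra.
    have : x ^+ 2 <= x ^+ 3 by rewrite exprS ler_peMl ?sqr_ge0// ltW.
    by rewrite /=; lra.
rewrite ge0_integralD//; last first.
  by apply: measurable_funTS; apply/measurable_EFinP; apply: measurable_funX; exact: measurableT_comp.
  exact/measurable_EFinP/measurable_indic.
apply: lte_add_pinfty => //.
rewrite integral_indic//.
apply: (@le_lt_trans _ _ (mu `[0%R, T])).
  by apply: le_measure; rewrite ?inE//; apply: measurableI.
by rewrite lebesgue_measure_itv/=; case: ifP => _; rewrite ?ltry// -EFinB ltry.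
Qed.

End truncated_function.

Section product_integral.
Variables (R : realType) (nu : {measure set R -> \bar R}).
Hypothesis nu_sf : sigma_finite setT nu.
Local Notation mu := (@lebesgue_measure R).
Local Notation D := (`[0%R, +oo[%classic : set R).

Lemma ge0_integral_levy_measure_mul (F G : R -> R) (r : R) :
  measurable_fun setT F -> measurable_fun setT G ->
  (forall s, 0 <= F s) -> (forall x, 0 <= G x) ->
  (\int[nu]_x (G x)%:E = r%:E)%E ->
  (\int[levy_measure nu_sf]_z (F z.1 * G z.2)%:E =
   r%:E * \int[mu]_(s in D) (F s)%:E)%E.
Proof.
move=> mF mG F0 G0 Gr; rewrite ge0_integral_levy_measure; last first.
- by move=> z; rewrite lee_fin mulr_ge0.
- apply/measurable_EFinP; apply: measurable_funM.
    by apply: measurableT_comp => //; exact: measurable_fst.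
  by apply: measurableT_comp => //; exact: measurable_snd.
have r0 : 0 <= r by rewrite -lee_fin -Gr; apply: integral_ge0 => x _; rewrite lee_fin.
have mG' : measurable_fun setT (EFin \o G) by exact/measurable_EFinP.
have mF' : measurable_fun D (EFin \o F).
  by apply/measurable_EFinP; exact: measurable_funTS.
have G0' x : setT x -> (0 <= (EFin \o G) x)%E by rewrite lee_fin.
have F0' x : D x -> (0 <= (EFin \o F) x)%E by rewrite lee_fin.
rewrite -ge0_integralZl//; apply: eq_integral => s _ /=.
under eq_integral do rewrite EFinM.
by rewrite ge0_integralZl ?lee_fin// Gr muleC.
Qed.

End product_integral.

(** * Moments of the small jumps and their normalized integrals *)

Section small_jumps.
Variables (R : realType) (nu : {measure set R -> \bar R}).
Hypothesis nu_sq : (\int[nu]_x (x ^+ 2)%:E < +oo)%E.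

Let B (eps : R) : set R := [set x | `|x| <= eps].

Lemma measurable_small_jumps eps : measurable (B eps).
Proof.
rewrite (_ : B eps = `[- eps, eps]%classic); first exact: measurable_itv.
by apply/seteqP; split => x; rewrite /B/= in_itv/= ler_norml.
Qed.

Let msq : measurable_fun setT (fun x : R => (x ^+ 2)%:E).
Proof. by apply/measurable_EFinP; exact: measurable_funX. Qed.

Let small_sq_lty eps : (\int[nu]_(x in B eps) (x ^+ 2)%:E < +oo)%E.
Proof.
apply: le_lt_trans nu_sq; apply: ge0_subset_integral => //.
- exact: measurable_small_jumps.
- by move=> x _; rewrite lee_fin sqr_ge0.
Qed.

Lemma small_jump_sd_sqr eps :
  (\int[nu]_x ((x * \1_(B eps) x) ^+ 2)%:E = (small_jump_sd nu eps ^+ 2)%:E)%E.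
Proof.
rewrite /small_jump_sd sqr_sqrtr; last by apply: Rintegral_ge0 => x _; exact: sqr_ge0.
rewrite /Rintegral fineK; last first.
  rewrite ge0_fin_numE; first exact: small_sq_lty.
  by apply: integral_ge0 => x _; rewrite lee_fin sqr_ge0.
rewrite [RHS]integral_mkcond; apply: eq_integral => x _.
rewrite patchE indicE /B; case: ifPn => _; first by rewrite mulr1.
by rewrite mulr0 expr0n.
Qed.

(** On [|x| <= eps] one factor of the cube is at most [eps]. Giving the integral as a real [r]
    records its finiteness, as the product formula for the intensity requires. *)
Lemma small_jump_cube eps : 0 < eps ->
  exists2 r, r <= eps * small_jump_sd nu eps ^+ 2 &
    (\int[nu]_x (`|x * \1_(B eps) x| ^+ 3)%:E = r%:E)%E.
Proof.
move=> eps0.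
have mB := measurable_small_jumps eps.
have mk : measurable_fun setT (fun x : R => x * \1_(B eps) x).
  by apply: measurable_funM => //; exact: measurable_indic.
have h : (\int[nu]_x (`|x * \1_(B eps) x| ^+ 3)%:E <=
    (eps * small_jump_sd nu eps ^+ 2)%:E)%E.
  rewrite EFinM -small_jump_sd_sqr -ge0_integralZl//.
  - apply: ge0_le_integral => //.
    + by apply/measurable_EFinP; apply: measurable_funX; exact: measurableT_comp.
    + by apply: emeasurable_funM => //; apply/measurable_EFinP; exact: measurable_funX.
    + move=> x _; rewrite -EFinM lee_fin -(real_normK (num_real (x * _))) exprS.
      rewrite ler_wpM2r ?exprn_ge0// indicE.
      have [xB|_] := boolP (x \in B eps); last by rewrite mulr0 normr0 ltW.
      by rewrite mulr1; move: xB; rewrite inE.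
  - by apply/measurable_EFinP; exact: measurable_funX.
  - by move=> x _; rewrite lee_fin sqr_ge0.
  - by rewrite lee_fin ltW.
exists (fine (\int[nu]_x (`|x * \1_(B eps) x| ^+ 3)%:E)%E); last first.
  rewrite fineK// ge0_fin_numE; first by rewrite (le_lt_trans h)// ltry.
  by apply: integral_ge0 => x _; rewrite lee_fin exprn_ge0.
rewrite -lee_fin fineK// ge0_fin_numE; first by rewrite (le_lt_trans h)// ltry.
by apply: integral_ge0 => x _; rewrite lee_fin exprn_ge0.
Qed.

End small_jumps.

Section lincomb_L3.
Context d (T : measurableType d) (R : realType) (mu : {measure set T -> \bar R}).
Variables (D : set T) (mD : measurable D).

Lemma norm_add_cube_le (x y : R) : `|x + y| ^+ 3 <= 8 * (`|x| ^+ 3 + `|y| ^+ 3).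
Proof.
have h : `|x + y| ^+ 3 <= (`|x| + `|y|) ^+ 3 by rewrite lerXn2r ?nnegrE// ler_normD.
apply: le_trans h _; have := normr_ge0 x; have := normr_ge0 y.
move: `|x| `|y| => a b b0 a0.
have : 0 <= (a + b) * (a - b) ^+ 2 by rewrite mulr_ge0 ?sqr_ge0// addr_ge0.
have : 0 <= a ^+ 3 by rewrite exprn_ge0.
have : 0 <= b ^+ 3 by rewrite exprn_ge0.
(* Convexity of the cube on nonnegative reals, as an identity with a nonnegative defect. *)
have -> : (a + b) ^+ 3 = 4 * (a ^+ 3 + b ^+ 3) - 3 * ((a + b) * (a - b) ^+ 2) by ring.
by lra.
Qed.

Lemma lincomb_L3_lty (n : nat) (f : 'I_n -> T -> R) (c : 'I_n -> R) :
  (forall i, measurable_fun D (f i)) ->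
  (forall i, \int[mu]_(x in D) (`|f i x| ^+ 3)%:E < +oo)%E ->
  (\int[mu]_(x in D) (`|(\sum_i c i * f i x)%R| ^+ 3)%:E < +oo)%E.
Proof.
move=> mf f3; elim: (index_enum 'I_n) => [|i s IH].
  under eq_integral do rewrite big_nil normr0 expr0n.
  by rewrite integral0.
have m3 (g : T -> R) : measurable_fun D g -> measurable_fun D (fun x => (`|g x| ^+ 3)%:E).
  by move=> mg; apply/measurable_EFinP; apply: measurable_funX; exact: measurableT_comp.
have mS : measurable_fun D (fun x => \sum_(j <- s) c j * f j x).
  by apply: measurable_sum => j; exact: measurable_funM.
have p3 (g : T -> R) x : D x -> (0 <= (`|g x| ^+ 3)%:E)%E by rewrite lee_fin exprn_ge0.
apply: (@le_lt_trans _ _ (\int[mu]_(x in D)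
    ((8 * `|c i| ^+ 3)%:E * (`|f i x| ^+ 3)%:E +
     8%:E * (`|(\sum_(j <- s) c j * f j x)%R| ^+ 3)%:E)))%E.
  apply: ge0_le_integral => //.
  - by apply: m3; apply: measurable_sum => j; exact: measurable_funM.
  - by apply: emeasurable_funD; apply: emeasurable_funM => //; exact: m3.
  - move=> x _; rewrite -!EFinM -EFinD lee_fin big_cons.
    by rewrite (le_trans (norm_add_cube_le _ _))// normrM exprMn mulrDr mulrA.
have mfi := m3 _ (mf i); have mS3 := m3 _ mS.
have c0 : (0 <= (8 * `|c i| ^+ 3)%:E)%E by rewrite lee_fin mulr_ge0// exprn_ge0.
have mA : measurable_fun D (fun x => (8 * `|c i| ^+ 3)%:E * (`|f i x| ^+ 3)%:E)%E.
  exact: emeasurable_funM.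
have mB : measurable_fun D
    (fun x => 8%:E * (`|(\sum_(j <- s) c j * f j x)%R| ^+ 3)%:E)%E.
  exact: emeasurable_funM.
rewrite (ge0_integralD _ mD _ mA _ mB); last 2 first.
- by move=> x _; rewrite mule_ge0// lee_fin exprn_ge0.
- by move=> x _; rewrite mule_ge0// lee_fin exprn_ge0.
rewrite ge0_integralZl//.
rewrite ge0_integralZl//.
by apply: lte_add_pinfty; apply: lte_mul_pinfty.
Qed.

End lincomb_L3.

Section small_jump_integrals.
Context (R : realType) (dO : measure_display) (Om : measurableType dO)
  (P : probability Om R) (nu : {measure set R -> \bar R}).
Hypothesis nu_sq : (\int[nu]_x (x ^+ 2)%:E < +oo)%E.
Hypothesis nu_sf : sigma_finite setT nu.
Variables (N : R.-ker Om ~> (R * R)%type).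
Hypothesis N_poisson : is_poisson_random_measure P N (levy_intensity nu).
Variables (n : nat) (h : 'I_n -> R -> R) (t : 'I_n -> R) (eps : R).
Local Notation hb i := (fun s : R => h i s * \1_(`[0, t i]) s).
Hypothesis mh : forall i, measurable_fun (setT : set R) (hb i).
Local Notation mu := (@lebesgue_measure R).
Local Notation D := (`[0%R, +oo[%classic : set R).
Hypothesis h2 : forall i, in_L2_Rplus (hb i).
Hypothesis h3 : forall i, (\int[mu]_(s in D) (`|hb i s| ^+ 3)%:E < +oo)%E.
Variable J : 'I_n -> {RV P >-> R}.
Hypothesis eps_gt0 : 0 < eps.
Hypothesis sd_gt0 : 0 < small_jump_sd nu eps.
Hypothesis J_int : forall i, is_compensated_integral N (levy_intensity nu)
  (small_jump_kernel (h i) (t i) eps) (J i).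
Variable u : 'I_n -> R.

Let sd := small_jump_sd nu eps.
Let H s := \sum_i u i * (h i s * \1_(`[0, t i]) s).
Let k (x : R) := x * \1_([set x | `|x| <= eps]) x.
Let f (z : R * R) := H z.1 * (sd^-1 * k z.2).
Let X w := \sum_i u i * (sd^-1 * J i w).
Local Notation m := (levy_measure nu_sf).

Let mH : measurable_fun setT H.
Proof. by apply: measurable_sum => i; exact: measurable_funM. Qed.

Let mk : measurable_fun setT k.
Proof.
apply: measurable_funM => //; apply: measurable_indic.
exact: measurable_small_jumps.
Qed.

Let mf : measurable_fun setT f.
Proof.
apply: measurable_funM; first by apply: measurableT_comp => //; exact: measurable_fst.
apply: measurable_funM => //.
by apply: measurableT_comp => //; exact: measurable_snd.
Qed.

Let mX : measurable_fun setT X.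
Proof. by apply: measurable_sum => i; do 2 apply: measurable_funM => //. Qed.

Let fX : compensated_L2_limit P N m f X.
Proof.
(* The indicator of the rectangle factorizes. Time then enters through the truncated [h i], which is
   measurable on the whole line, and the kernel separates into a function of [s] and one of [x]. *)
have kE i z : small_jump_kernel (h i) (t i) eps z =
    (h i z.1 * \1_(`[0, t i]) z.1) * k z.2.
  rewrite /small_jump_kernel /k !indicE in_setX.
  case: (z.1 \in _); case: (z.2 \in _) => /=; ring.
have mker i : measurable_fun setT (small_jump_kernel (h i) (t i) eps).
  rewrite (_ : small_jump_kernel _ _ _ =
      fun z => (h i z.1 * \1_(`[0, t i]) z.1) * k z.2); last exact/funext/kE.
  apply: measurable_funM.
    by apply: (measurableT_comp (mh i)); exact: measurable_fst.
  by apply: measurableT_comp => //; exact: measurable_snd.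
have mJ i : measurable_fun setT (J i) by [].
have := @compensated_L2_limit_sum _ _ _ _ _ P N m N_poisson n
  (fun i => u i * sd^-1) (fun i => small_jump_kernel (h i) (t i) eps)
  (fun i => J i) mker mJ.
rewrite (_ : (fun z => _) = f); last first.
  apply/funext => z; rewrite /f /H mulr_suml; apply: eq_bigr => i _.
  by rewrite kE; ring.
rewrite (_ : (fun w => _) = X); last first.
  by apply/funext => w; apply: eq_bigr => i _; rewrite mulrA.
apply => i; have [g [g1 g2 g3]] := J_int i; exists g; split => //.
by move: g3; rewrite unlock.
Qed.

Let sd_neq0 : sd != 0. Proof. by rewrite gt_eqF. Qed.

Let H2_integrable : mu.-integrable D (EFin \o (fun s => H s ^+ 2)).
Proof.
apply: sqr_integrable_lty => //; first exact: measurable_funTS.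
have iff i j : mu.-integrable D (EFin \o (fun s : R =>
    (h i s * \1_(`[0, t i]) s) * (h j s * \1_(`[0, t j]) s))).
  have [mi hi] := h2 i; have [mj hj] := h2 j.
  by apply: integrable_mul_of_sqr => //; exact: sqr_integrable_lty.
have : mu.-integrable D (EFin \o (fun s => \sum_i \sum_j u i * (u j *
    ((h i s * \1_(`[0, t i]) s) * (h j s * \1_(`[0, t j]) s))))).
  apply: integrableRsum => // i; apply: integrableRsum => // j.
  by apply: integrableRZ => //; apply: integrableRZ => //; exact: iff.
move=> /integrable_lty; rewrite (_ : (fun s => (H s ^+ 2)%:E) = EFin \o (fun s => \sum_i \sum_j u i * (u j *
    ((h i s * \1_(`[0, t i]) s) * (h j s * \1_(`[0, t j]) s)))))//.
  by apply.
apply/funext => s /=; rewrite /H expr2 mulr_suml; congr (_%:E).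
apply: eq_bigr => i _; rewrite mulr_sumr; apply: eq_bigr => j _; ring.
Qed.

Let H3_lty : (\int[mu]_(s in D) (`|H s| ^+ 3)%:E < +oo)%E.
Proof.
by apply: lincomb_L3_lty => // i; have [] := h2 i.
Qed.

(** By separation of variables the jump factor is the integral of [k^2], that is [sd^2], and the
    normalization cancels it exactly: the limiting variance is attained for each [eps]. *)
Let f_sqr : (\int[m]_z (f z ^+ 2)%:E = (\int[mu]_(s in D) (H s ^+ 2))%:E)%E.
Proof.
transitivity (\int[m]_z ((sd^-1 * H z.1) ^+ 2 * k z.2 ^+ 2)%:E)%E.
  by apply: eq_integral => z _; rewrite /f; congr (_%:E); ring.
rewrite (ge0_integral_levy_measure_mul nu_sf (F := fun s => (sd^-1 * H s) ^+ 2)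
  (G := fun x => k x ^+ 2) (r := sd ^+ 2)).
- rewrite /Rintegral fineK; last exact: integrable_fin_num H2_integrable.
  rewrite -ge0_integralZl//.
  + apply: eq_integral => s _; rewrite -EFinM; congr (_%:E).
    by field.
  + by apply/measurable_EFinP; apply: measurable_funTS; apply: measurable_funX; exact: measurable_funM.
  + by move=> s _; rewrite lee_fin sqr_ge0.
  + by rewrite lee_fin sqr_ge0.
- by apply: measurable_funX; exact: measurable_funM.
- exact: measurable_funX.
- by move=> s; exact: sqr_ge0.
- by move=> s; exact: sqr_ge0.
- exact: small_jump_sd_sqr.
Qed.

Let f_sqrR : Rintegral m setT (fun z => f z ^+ 2) = \int[mu]_(s in D) (H s ^+ 2).
Proof. by rewrite [LHS]/Rintegral f_sqr. Qed.

Let f_cube : (\int[m]_z (`|f z| ^+ 3)%:E <=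
  (eps / sd * \int[mu]_(s in D) (`|H s| ^+ 3))%:E)%E.
Proof.
have [r r_le kr] := small_jump_cube nu_sq eps_gt0.
have iH3 : mu.-integrable D (EFin \o (fun s => `|H s| ^+ 3)).
  apply/integrableP; split.
    apply: measurable_funTS; apply/measurable_EFinP; apply: measurable_funX.
    exact: measurableT_comp.
  by under eq_integral do rewrite /= ger0_norm ?exprn_ge0//.
have -> : (\int[m]_z (`|f z| ^+ 3)%:E =
    (r * (sd^-1 ^+ 3 * \int[mu]_(s in D) (`|H s| ^+ 3)))%:E)%E.
  transitivity (\int[m]_z ((sd^-1 ^+ 3 * `|H z.1| ^+ 3) * `|k z.2| ^+ 3)%:E)%E.
    apply: eq_integral => z _; rewrite /f !normrM (gtr0_norm (_ : 0 < sd^-1)) ?invr_gt0//.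
    by congr (_%:E); ring.
  rewrite (ge0_integral_levy_measure_mul nu_sf (F := fun s => sd^-1 ^+ 3 * `|H s| ^+ 3)
    (G := fun x => `|k x| ^+ 3) (r := r)).
  - rewrite EFinM; congr (_ * _)%E.
    have iz : mu.-integrable D (EFin \o (fun s => sd^-1 ^+ 3 * `|H s| ^+ 3)).
      exact: integrableRZ.
    rewrite -[LHS]fineK; first by congr (_%:E); exact: RintegralZl.
    exact: integrable_fin_num iz.
  - apply: measurable_funM => //; apply: measurable_funX; exact: measurableT_comp.
  - by apply: measurable_funX; exact: measurableT_comp.
  - by move=> s; rewrite mulr_ge0// ?exprn_ge0// invr_ge0 ltW.
  - by move=> s; rewrite exprn_ge0.
  - exact: kr.
rewrite lee_fin mulrA ler_wpM2r//.
  by apply: Rintegral_ge0 => s _; rewrite exprn_ge0.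
apply: (@le_trans _ _ (eps * sd ^+ 2 * sd^-1 ^+ 3)).
  by rewrite ler_wpM2r// exprn_ge0// invr_ge0 ltW.
by rewrite le_eqVlt; apply/orP; left; apply/eqP; field.
Qed.

Let if2 : m.-integrable setT (EFin \o (fun z => f z ^+ 2)).
Proof. by apply: sqr_integrable_lty => //; rewrite f_sqr ltry. Qed.

Let if3 : m.-integrable setT (EFin \o (fun z => `|f z| ^+ 3)).
Proof.
apply/integrableP; split.
  by apply/measurable_EFinP; apply: measurable_funX; exact: measurableT_comp.
under eq_integral do rewrite /= ger0_norm ?exprn_ge0//.
by rewrite (le_lt_trans f_cube)// ltry.
Qed.

Lemma small_jump_lincomb_sqr :
  ('E_P[fun w => ((\sum_i u i * (sd^-1 * J i w)) ^+ 2)%R] <=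
   (\int[mu]_(s in D) ((\sum_i u i * (h i s * \1_(`[0%R, t i]) s)) ^+ 2))%:E)%E.
Proof.
have := compensated_L2_limit_sqr (m := m) N_poisson mf mX if2 if3 fX.
by rewrite f_sqrR.
Qed.

Lemma small_jump_lincomb_cos (b : R) :
  `|\int[P]_w cos (\sum_i u i * (sd^-1 * J i w) + b) -
    expR (- ((\int[mu]_(s in D) ((\sum_i u i * (h i s * \1_(`[0, t i]) s)) ^+ 2)) / 2))
      * cos b| <=
  8 * (eps / sd * \int[mu]_(s in D) (`|\sum_i u i * (h i s * \1_(`[0, t i]) s)| ^+ 3)).
Proof.
have := compensated_L2_limit_cos (m := m) N_poisson b mf mX if2 if3 fX.
rewrite f_sqrR => /le_trans; apply.
rewrite ler_pM2l// -lee_fin; apply: le_trans f_cube.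
by rewrite /Rintegral fineK//; exact: integrable_fin_num if3.
Qed.

End small_jump_integrals.

(** Divergence of the ratio also makes [sd eps] positive near 0, so that the normalization
    [(sd eps)^-1] is a true inverse there and not the default value 0. *)
Lemma small_ratio_near (R : realType) (sd : R -> R) (e : R) : 0 < e ->
  sd eps / eps @[eps --> 0^'+] --> +oo ->
  \forall eps \near 0^'+, [/\ 0 < eps, 0 < sd eps & eps / sd eps <= e].
Proof.
move=> e0 /cvgryPge /(_ e^-1) h.
near=> eps.
have p0 : 0 < eps by near: eps; exact: nbhs_right_gt.
have s : e^-1 <= sd eps / eps by near: eps.
have sd0 : 0 < sd eps.
  by rewrite -(pmulr_lgt0 _ (_ : 0 < eps^-1)) ?invr_gt0// (lt_le_trans _ s)// invr_gt0.
split => //.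
by rewrite ler_pdivrMr// -ler_pdivrMl// mulrC; move: s; rewrite ler_pdivlMr// mulrC.
Unshelve. all: by end_near. Qed.
Theorem theorem3 (R : realType)
    (dO : measure_display) (Om : measurableType dO) (P : probability Om R)
    (dO' : measure_display) (Om' : measurableType dO') (P' : probability Om' R)
    (nu : {measure set R -> \bar R})
    (nu_levy : is_levy_measure nu)
    (nu_neq0 : nu [set: R] <> 0%E)
    (nu_sq : (\int[nu]_x (x ^+ 2)%:E < +oo)%E)
    (N : R.-ker Om ~> (R * R)%type)
    (N_poisson : is_poisson_random_measure P N (levy_intensity nu))
    (T : R) (T_gt0 : 0 < T)
    (h : R -> R -> R)
    (h_meas : forall t, 0 <= t <= T -> measurable_fun (`]0, T[ : set R) (h t))
    (h_L3 : forall t, 0 <= t <= T ->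
      (\int[lebesgue_measure]_(s in `]0%R, T[) (`|h t s| ^+ 3)%:E < +oo)%E)
    (J : R -> R -> {RV P >-> R})
    (J_int : forall eps t, 0 < eps -> 0 <= t <= T ->
      is_compensated_integral N (levy_intensity nu)
        (small_jump_kernel (h t) t eps) (J eps t))
    (W : (R -> R) -> {RV P' >-> R})
    (W_isonormal : is_isonormal W)
    (sigma_oo : small_jump_sd nu eps / eps @[eps --> 0^'+] --> +oo)
    (d : nat) (t : 'I_d -> R) (ht : forall i, 0 <= t i <= T) :
  cvg_in_law_at_right0 P P'
    (fun eps w => \row_i ((small_jump_sd nu eps)^-1 * J eps (t i) w))
    (fun w => \row_i W (fun s => h (t i) s * \1_(`[0, t i]) s) w).
Proof.
have nu_sf := sqr_integrable_sigma_finite nu_levy.1 nu_sq.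
pose hb i s := h (t i) s * \1_(`[0, t i]) s.
have mh i : measurable_fun (setT : set R) (hb i).
  exact: (measurable_truncated (ht i) (h_meas _ (ht i))).
have h2 i : in_L2_Rplus (hb i).
  exact: (truncated_L2 (ht i) (h_meas _ (ht i)) (h_L3 _ (ht i))).
have h3 i : (\int[lebesgue_measure]_(s in `[0%R, +oo[) (`|hb i s| ^+ 3)%:E < +oo)%E.
  exact: (truncated_L3 (ht i) (h_meas _ (ht i)) (h_L3 _ (ht i))).
pose S i := \int[lebesgue_measure]_(s in `[0%R, +oo[) (hb i s ^+ 2).
have S_ge0 i : 0 <= S i by apply: Rintegral_ge0 => s _; exact: sqr_ge0.
have S_le i : S i <= \sum_j S j.
  by rewrite (bigD1 i)//= lerDl sumr_ge0.
have mJ eps i : measurable_fun setT (fun w => (small_jump_sd nu eps)^-1 * J eps (t i) w).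
  exact: measurable_funM.
(* A coordinate is the linear combination with a unit vector of coefficients, which brings its
   second moment under the estimate for combinations. *)
have delta_sum (a : 'I_d -> R) i : \sum_j (j == i)%:R * a j = a i.
  rewrite (bigD1 i)//= eqxx mul1r big1 ?addr0// => j /negPf ->; exact: mul0r.
(* One constant bounds the second moments of all coordinates, before and in the limit. *)
apply: (@cvg_in_law_of_cos _ _ _ _ _ _ _ _ _ _ (\sum_j S j)).
- by move=> eps i; under eq_fun do rewrite mxE; exact: mJ.
- by move=> i; under eq_fun do rewrite mxE; exact: measurable_funPT.
- near=> eps.
  have [eps0 sd0 _] : [/\ 0 < eps, 0 < small_jump_sd nu eps
      & eps / small_jump_sd nu eps <= 1].
    by near: eps; exact: small_ratio_near.
  move=> i; under eq_fun do rewrite mxE.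
  have := small_jump_lincomb_sqr nu_sq nu_sf N_poisson mh h2 h3 eps0 sd0
    (fun j => J_int _ _ eps0 (ht j)) (fun j => (j == i)%:R).
  under eq_fun do rewrite delta_sum.
  under eq_Rintegral do rewrite delta_sum.
  by move=> /le_trans; apply; rewrite lee_fin; exact: S_le.
- move=> i; under eq_fun do rewrite mxE.
  by rewrite (isonormal_sqr W_isonormal h2) lee_fin; exact: S_le.
move=> u b.
have -> : (fun eps => \int[P]_w cos (\sum_i u i *
      (\row_i ((small_jump_sd nu eps)^-1 * J eps (t i) w)) ord0 i + b)) =
    fun eps => \int[P]_w cos (\sum_i u i * ((small_jump_sd nu eps)^-1 * J eps (t i) w) + b).
  apply/funext => eps; apply: eq_Rintegral => w _; congr (cos (_ + b)).
  by apply: eq_bigr => i _; rewrite mxE.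
have E2 w : \sum_i u i * (\row_i (W (hb i) w)) ord0 i = \sum_i u i * W (hb i) w.
  by apply: eq_bigr => i _; rewrite mxE.
under eq_Rintegral do rewrite E2.
(* The limit is now the very Gaussian value with which [small_jump_lincomb_cos] compares, so that
   only its error term remains. *)
rewrite (isonormal_cos W_isonormal h2).
apply/cvgrPdist_le => e e0.
pose C3 := \int[lebesgue_measure]_(s in `[0%R, +oo[) (`|\sum_i u i * hb i s| ^+ 3).
have C3_ge0 : 0 <= C3 by apply: Rintegral_ge0 => s _; exact: exprn_ge0.
(* The error is [8 (eps / sigma) C3]; [1 + C3] replaces [C3], which may be 0, in the denominator. *)
have e'0 : 0 < e / (8 * (1 + C3)) by rewrite divr_gt0// mulr_gt0// ltr_pwDl.
near=> eps.
have [eps0 sd0 eps_sd] : [/\ 0 < eps, 0 < small_jump_sd nu eps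
    & eps / small_jump_sd nu eps <= e / (8 * (1 + C3))].
  by near: eps; exact: small_ratio_near.
rewrite distrC.
have := small_jump_lincomb_cos nu_sq nu_sf N_poisson mh h2 h3 eps0 sd0
    (fun j => J_int _ _ eps0 (ht j)) u b.
move=> /le_trans; apply.
apply: (@le_trans _ _ (8 * (e / (8 * (1 + C3)) * (1 + C3)))).
  rewrite ler_pM2l// ler_pM// ?lerDr//; first by rewrite divr_ge0// ltW.
by rewrite le_eqVlt; apply/orP; left; apply/eqP; field; rewrite gt_eqF// ltr_pwDl.
Unshelve. all: by end_near. Qed.
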